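(* Let $U$ be a connected domain in $\mathbf{R}^2$, and let $f:U\to (M^3,g)$ be a real analytic immersion into an oriented real analytic Lorentzian $3$-manifold $(M^3,g)$. Let $U_+$ (resp. $U_-$) be the set of points of $U$ where $f$ is space-like (resp. time-like). Suppose that $U_+$ and $U_-$ are both non-empty, and that the mean curvature function $H$ of $f$, defined on $U_+\cup U_-$, is bounded. Let $\overline{U_+},\overline{U_-}$ denote the closures of $U_+,U_-$ in $U$. Then for each $p\in \overline{U_+}\cap \overline{U_-}$ there exists a sequence $\{p_n\}_{n=1,2,3,\dots}$ in $U_+$ converging to $p$ such that $\lim_{n\to\infty}H(p_n)=0$, and there likewise exists a sequence $\{p_n\}_{n=1,2,3,\dots}$ in $U_-$ converging to $p$ such that $\lim_{n\to\infty}H(p_n)=0$.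
   Context: Lorentzian metrics have signature $(-,+,+)$. Let $(u,v)$ be the coordinates of $U\subset\mathbf{R}^2$, $f_u:=df(\partial_u)$, $f_v:=df(\partial_v)$, and $$g_{11}:=g(f_u,f_u),\quad g_{12}=g_{21}:=g(f_u,f_v),\quad g_{22}:=g(f_v,f_v),\quad \beta:=g_{11}g_{22}-g_{12}^2 .$$ The set of space-like points is $U_+:=\{p\in U:\beta(p)>0\}$ and the set of time-like points is $U_-:=\{p\in U:\beta(p)<0\}$. For tangent vectors $\mathbf v,\mathbf w\in T_pM^3$ spanning a non-degenerate plane, the vector product $\mathbf v\times_g\mathbf w$ is the tangent vector such that: (i) it is $g$-orthogonal to $\mathbf v$ and $\mathbf w$; (ii) $\{\mathbf v,\mathbf w,\mathbf v\times_g\mathbf w\}$ is a basis of $T_pM^3$ compatible with the orientation of $M^3$; (iii) $g_p(\mathbf v\times_g\mathbf w,\mathbf v\times_g\mathbf w)=-g_p(\mathbf v,\mathbf v)g_p(\mathbf w,\mathbf w)+g_p(\mathbf v,\mathbf w)^2$. Write $|\mathbf v|:=\sqrt{|g_p(\mathbf v,\mathbf v)|}$. The unit normal vector field of $f$ on $U_+\cup U_-$ is $\nu:=\dfrac{f_u\times_g f_v}{|f_u\times_g f_v|}$. With $\nabla$ the Levi-Civita connection of $(M^3,g)$, put $f_{uu}=\nabla_{\partial_u}f_u$, $f_{uv}=\nabla_{\partial_v}f_u=\nabla_{\partial_u}f_v$, $f_{vv}=\nabla_{\partial_v}f_v$ (covariant derivatives along $f$), and $h_{11}:=g(f_{uu},\nu)$,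 $h_{12}=h_{21}:=g(f_{uv},\nu)$, $h_{22}:=g(f_{vv},\nu)$ on $U_+\cup U_-$. The mean curvature function is $$H:=\frac{g_{11}h_{22}-2g_{12}h_{12}+g_{22}h_{11}}{2|\beta|}\qquad\text{on }U_+\cup U_-.$$ *)

(* Defs.v *)
From HB Require Import structures.
From mathcomp Require Import all_boot all_order all_algebra.
From mathcomp Require Import all_classical all_reals all_analysis.

Set Implicit Arguments.
Unset Strict Implicit.
Unset Printing Implicit Defensive.

Import Order.TTheory GRing.Theory Num.Theory.
Import numFieldNormedType.Exports.

Local Open Scope classical_set_scope.
Local Open Scope ring_scope.

(* Sum of the terms c_a h^a over the multi-indices a with all a_i < N. *)
Definition box_sum (R : realType) (n : nat) (c : ('I_n -> nat) -> R)
    (h : 'rV[R]_n) (N : nat) : R :=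
  \sum_(a : {ffun 'I_n -> 'I_N})
    c (fun i => a i : nat) * \prod_(i < n) h 0 i ^+ a i.

(* On a ball (a polydisc: the norm of 'rV[R]_n is the sup norm), f is the sum
   of an absolutely convergent power series centred at x0. Under absolute
   convergence the order of summation is irrelevant, so the partial sums over
   the boxes [0,N)^n suffice. *)
Definition analytic_at (R : realType) (n : nat) (f : 'rV[R]_n -> R)
    (x0 : 'rV[R]_n) : Prop :=
  exists r : R, 0 < r /\
  exists c : ('I_n -> nat) -> R,
  forall x : 'rV[R]_n, `|x - x0| < r ->
    cvgn (box_sum (fun a => `|c a|) (map_mx Num.norm (x - x0))) /\
    box_sum c (x - x0) N @[N --> \oo] --> f x.

Definition analytic_on (R : realType) (n : nat) (D : set 'rV[R]_n)
    (f : 'rV[R]_n -> R) : Prop :=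
  forall x, D x -> analytic_at f x.

(* [fwd] and [bwd] are total; only [fwd] on [dom] and [bwd] on [fwd @` dom]
   are meaningful. *)
Record chart (R : realType) (M : topologicalType) := Chart {
  dom : set M;
  fwd : M -> 'rV[R]_3;
  bwd : 'rV[R]_3 -> M;
  dom_open : open dom;
  img_open : open (fwd @` dom);
  fwdK : forall p, dom p -> bwd (fwd p) = p;
  fwd_continuous : {within dom, continuous fwd};
  bwd_continuous : {within fwd @` dom, continuous bwd} }.

Definition transition (R : realType) (M : topologicalType) (c c' : chart R M) :
    'rV[R]_3 -> 'rV[R]_3 :=
  fwd c' \o bwd c.

Definition overlap (R : realType) (M : topologicalType) (c c' : chart R M) :
    set 'rV[R]_3 :=
  fwd c @` (dom c `&` dom c').

(* The orientation is the one determined by the atlas, whose coordinate changes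
   all have positive Jacobian. [chart_at] singles out one chart around each
   point; it only serves to represent tangent vectors (see below). *)
Record oriented_analytic_manifold (R : realType) (M : topologicalType) :=
    OrientedAnalyticManifold {
  atlas : set (chart R M);
  chart_at : M -> chart R M;
  chart_at_atlas : forall p, atlas (chart_at p);
  chart_at_dom : forall p, dom (chart_at p) p;
  transition_analytic : forall c c', atlas c -> atlas c' ->
    forall k : 'I_3, analytic_on (overlap c c') (fun x => transition c c' x 0 k);
  transition_oriented : forall c c', atlas c -> atlas c' ->
    forall x, overlap c c' x -> 0 < \det ('J (transition c c') x);
  manifold_hausdorff : hausdorff_space M;
  manifold_second_countable : @second_countable M }.

(* A tangent vector v in T_pM is represented by its components v : 'rV[R]_3 in
   the chart [chart_at A p]. *)

(* The components in the chart c of v in T_pM, for p in [dom c]. *)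
Definition comp_in (R : realType) (M : topologicalType)
    (A : oriented_analytic_manifold R M) (c : chart R M) (p : M)
    (v : 'rV[R]_3) : 'rV[R]_3 :=
  'D_v (transition (chart_at A p) c) (fwd (chart_at A p) p).

(* Conversely, the vector at [bwd c x] whose components in the chart c are a. *)
Definition of_comp (R : realType) (M : topologicalType)
    (A : oriented_analytic_manifold R M) (c : chart R M) (x : 'rV[R]_3)
    (a : 'rV[R]_3) : 'rV[R]_3 :=
  'D_a (transition c (chart_at A (bwd c x))) x.

Definition bilin (R : realType) (G : 'M[R]_3) (v w : 'rV[R]_3) : R :=
  (v *m G *m w^T) 0 0.

Definition minkowski (R : realType) : 'M[R]_3 :=
  diag_mx (\row_i (if i == 0 then -1 else 1)).

Record lorentzian_metric (R : realType) (M : topologicalType)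
    (A : oriented_analytic_manifold R M) := LorentzianMetric {
  gram : M -> 'M[R]_3;
  gram_sym : forall p, (gram p)^T = gram p;
  gram_signature : forall p, exists P : 'M[R]_3,
    P \in unitmx /\ P *m gram p *m P^T = minkowski R;
  gram_analytic : forall c, atlas A c -> forall a b : 'rV[R]_3,
    analytic_on (fwd c @` dom c)
      (fun x => bilin (gram (bwd c x)) (of_comp A c x a) (of_comp A c x b)) }.

Definition inner (R : realType) (M : topologicalType)
    (A : oriented_analytic_manifold R M) (g : lorentzian_metric A) (p : M)
    (v w : 'rV[R]_3) : R :=
  bilin (gram g p) v w.

(* g(a^i d_i, b^j d_j) at the point of coordinates x in the chart c. *)
Definition inner_in (R : realType) (M : topologicalType)
    (A : oriented_analytic_manifold R M) (g : lorentzian_metric A)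
    (c : chart R M) (x a b : 'rV[R]_3) : R :=
  inner g (bwd c x) (of_comp A c x a) (of_comp A c x b).

Definition pnorm (R : realType) (M : topologicalType)
    (A : oriented_analytic_manifold R M) (g : lorentzian_metric A) (p : M)
    (v : 'rV[R]_3) : R :=
  Num.sqrt `|inner g p v v|.

(* The basis condition and its compatibility with the orientation are both
   expressed by the positivity of the determinant, since [chart_at A p] is a
   positively oriented chart. *)
Definition is_vector_product (R : realType) (M : topologicalType)
    (A : oriented_analytic_manifold R M) (g : lorentzian_metric A) (p : M)
    (v w z : 'rV[R]_3) : Prop :=
  [/\ inner g p z v = 0 /\ inner g p z w = 0,
      0 < \det (col_mx v (col_mx w z) : 'M[R]_3)
    & inner g p z z = - inner g p v v * inner g p w w + inner g p v w ^+ 2].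

(* Only meaningful when v and w span a non-degenerate plane. *)
Definition vector_product (R : realType) (M : topologicalType)
    (A : oriented_analytic_manifold R M) (g : lorentzian_metric A) (p : M)
    (v w : 'rV[R]_3) : 'rV[R]_3 :=
  xget 0 [set z | is_vector_product g p v w z].

(* [christoffel c x k i j] is the coefficient Gamma^k_ij in the chart c, at the
   point of coordinates x. *)
Definition christoffel_form (R : realType) (Gamma : 'I_3 -> 'M[R]_3)
    (a b : 'rV[R]_3) : 'rV[R]_3 :=
  \row_k bilin (Gamma k) a b.

(* [christoffel_change] says that nabla_a Y = D_a Y + Gamma(a, Y) does not
   depend on the chart: with tau = transition c c',
   D tau (Gamma(a, b)) = D^2 tau (a, b) + Gamma'(D tau a, D tau b).
   No regularity of the coefficients is imposed: the coefficients of the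
   Levi-Civita connection are determined by the metric, hence analytic. *)
Record affine_connection (R : realType) (M : topologicalType)
    (A : oriented_analytic_manifold R M) := AffineConnection {
  christoffel : chart R M -> 'rV[R]_3 -> 'I_3 -> 'M[R]_3;
  christoffel_change : forall c c', atlas A c -> atlas A c' ->
    forall x, overlap c c' x -> forall a b : 'rV[R]_3,
    let tau := transition c c' in
    'D_(christoffel_form (christoffel c x) a b) tau x =
    'D_a (fun y => 'D_b tau y) x +
    christoffel_form (christoffel c' (tau x)) ('D_a tau x) ('D_b tau x) }.

Definition torsion_free (R : realType) (M : topologicalType)
    (A : oriented_analytic_manifold R M) (nabla : affine_connection A) : Prop :=
  forall c, atlas A c -> forall x, (fwd c @` dom c) x -> forall a b : 'rV[R]_3,
    christoffel_form (christoffel nabla c x) a b =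
    christoffel_form (christoffel nabla c x) b a.

(* nabla g = 0, tested on coordinate vector fields a, b with constant
   components. *)
Definition metric_compatible (R : realType) (M : topologicalType)
    (A : oriented_analytic_manifold R M) (g : lorentzian_metric A)
    (nabla : affine_connection A) : Prop :=
  forall c, atlas A c -> forall x, (fwd c @` dom c) x ->
  forall w a b : 'rV[R]_3,
    let Gamma := christoffel_form (christoffel nabla c x) in
    'D_w (fun y => inner_in g c y a b) x =
    inner_in g c x (Gamma w a) b + inner_in g c x a (Gamma w b).

Definition is_levi_civita (R : realType) (M : topologicalType)
    (A : oriented_analytic_manifold R M) (g : lorentzian_metric A)
    (nabla : affine_connection A) : Prop :=
  torsion_free nabla /\ metric_compatible g nabla.

Definition tangent_map (R : realType) (M : topologicalType)
    (A : oriented_analytic_manifold R M) (f : 'rV[R]_2 -> M)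
    (q w : 'rV[R]_2) : 'rV[R]_3 :=
  'D_w (fwd (chart_at A (f q)) \o f) q.

Definition analytic_map (R : realType) (M : topologicalType)
    (A : oriented_analytic_manifold R M) (U : set 'rV[R]_2)
    (f : 'rV[R]_2 -> M) : Prop :=
  {within U, continuous f} /\
  forall c, atlas A c -> forall k : 'I_3,
    analytic_on (U `&` f @^-1` dom c) (fun q => fwd c (f q) 0 k).

Definition analytic_immersion (R : realType) (M : topologicalType)
    (A : oriented_analytic_manifold R M) (U : set 'rV[R]_2)
    (f : 'rV[R]_2 -> M) : Prop :=
  analytic_map A U f /\ forall q, U q -> injective (tangent_map A f q).

(* (nabla_w X)(q) for a vector field X along f: differentiate the components
   of X in a fixed chart around f q, then add the Christoffel term. *)
Definition cov_deriv (R : realType) (M : topologicalType)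
    (A : oriented_analytic_manifold R M) (nabla : affine_connection A)
    (f : 'rV[R]_2 -> M) (w : 'rV[R]_2) (X : 'rV[R]_2 -> 'rV[R]_3)
    (q : 'rV[R]_2) : 'rV[R]_3 :=
  let c := chart_at A (f q) in
  'D_w (fun q' => comp_in A c (f q') (X q')) q +
  christoffel_form (christoffel nabla c (fwd c (f q)))
    (tangent_map A f q w) (X q).

Section Surface.
Context {R : realType} {M : topologicalType}
  {A : oriented_analytic_manifold R M} (g : lorentzian_metric A)
  (nabla : affine_connection A) (U : set 'rV[R]_2) (f : 'rV[R]_2 -> M).
Implicit Types q : 'rV[R]_2.

Definition du : 'rV[R]_2 := delta_mx 0 0.
Definition dv : 'rV[R]_2 := delta_mx 0 1.

Definition fu q := tangent_map A f q du.
Definition fv q := tangent_map A f q dv.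

Definition g11 q := inner g (f q) (fu q) (fu q).
Definition g12 q := inner g (f q) (fu q) (fv q).
Definition g22 q := inner g (f q) (fv q) (fv q).

Definition beta q := g11 q * g22 q - g12 q ^+ 2.

Definition spacelike_points : set 'rV[R]_2 := [set q | U q /\ 0 < beta q].
Definition timelike_points : set 'rV[R]_2 := [set q | U q /\ beta q < 0].

Definition unit_normal q : 'rV[R]_3 :=
  let n := vector_product g (f q) (fu q) (fv q) in
  (pnorm g (f q) n)^-1 *: n.

Definition fuu := cov_deriv nabla f du fu.
Definition fuv := cov_deriv nabla f dv fu.
Definition fvv := cov_deriv nabla f dv fv.

Definition h11 q := inner g (f q) (fuu q) (unit_normal q).
Definition h12 q := inner g (f q) (fuv q) (unit_normal q).
Definition h22 q := inner g (f q) (fvv q) (unit_normal q).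

(* Only meaningful where beta q <> 0. *)
Definition mean_curvature q : R :=
  (g11 q * h22 q - 2 * g12 q * h12 q + g22 q * h11 q) / (2 * `|beta q|).

End Surface.

(* Main.v *)
(* Let [beta] be the determinant of the first fundamental form, so that
   [H ^+ 2 = l ^+ 2 / (4 * `|det G| * `|beta| ^+ 3)], where [l] is the numerator
   of [H] computed with an unnormalized normal; both [beta] and [l] are real
   analytic, even across light-like points. Given [p] in both closures, join a
   space-like and a time-like point near [p] by a segment. Along it [beta] is
   analytic in one variable and changes sign, hence has a zero of odd order [k] at
   some point. Since [H] is bounded, [l ^+ 2 = O(t ^+ (3 * k))], and as [3 * k] is
   odd, [l ^+ 2 = O(t ^+ (3 * k).+1)]. So [H] tends to [0] on both sides of this
   zero, on one of which the surface is space-like and on the other time-like.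

   Analyticity of compositions and of derivatives is obtained from Banach algebras
   of absolutely convergent power series: an analytic function can be substituted
   into any of them, and adjoining a variable to an algebra gives its derivatives.
   The Christoffel symbols enter through the Koszul formula, in which the inverse
   of the metric does not occur. *)

Require Import Defs.
From HB Require Import structures.
From mathcomp Require Import all_boot all_order all_algebra.
From mathcomp Require Import all_classical all_reals all_analysis.
From mathcomp Require Import ring lra.

Set Implicit Arguments.
Unset Strict Implicit.
Unset Printing Implicit Defensive.

Import Order.TTheory GRing.Theory Num.Theory.
Import numFieldNormedType.Exports.

Local Open Scope classical_set_scope.
Local Open Scope ring_scope.

(** * Algebras of functions with summable power series *)

(** Two features of the definitions shape the proof. Tangent vectors are written in a chart chosen
    separately at each point, so their components and the Gram matrices need not vary continuously;
    every invariant is therefore rewritten in one chart, fixed around the point under study. And the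
    unit normal contains [sqrt |beta|], which breaks down at light-like points. Squaring removes the
    root together with the sign of the normal: the vector product has square [-beta] and the
    unnormalized normal has [\det G * beta], whence the factor [|\det G|]; the denominator
    [2 * |beta|] and the normalization together give [4 * |beta|^3].

    Analyticity is phrased with constants [rho] and [K] that do not depend on the algebra. The same
    [K] is thus valid after a variable has been adjoined, and derivatives are read off as
    coefficients, without rearranging series over multi-indices.

    The zero found on the segment need not be [p]. It is only close to [p], which suffices for a
    sequence. *)

Lemma cvg_norm_le (R : realType) (u : R^nat) (l K : R) :
  u @ \oo --> l -> (forall n, `|u n| <= K) -> `|l| <= K.
Proof.
move=> ul uK; apply: ler_cvg_to (cvg_norm ul) (cvg_cst K) _; exact: nearW.
Qed.

Lemma ler_norm_series (R : realType) (u k : R^nat) (n : nat) :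
  (forall m, `|u m| <= k m) -> `|series u n| <= series k n.
Proof.
move=> uk; rewrite /series /=; apply: le_trans (ler_norm_sum _ _ _) _.
exact: ler_sum.
Qed.

Lemma bounded_series_cvg (R : realType) (k : R^nat) (K : R) :
  (forall m, 0 <= k m) -> (forall n, series k n <= K) -> cvgn (series k).
Proof.
move=> k0 kK; apply: nondecreasing_is_cvgn; first exact: nondecreasing_series.
by exists K => _ [n _ <-].
Qed.

Lemma dominated_series_cvg (R : realType) (u k : R^nat) (K : R) :
  (forall m, `|u m| <= k m) -> (forall n, series k n <= K) ->
  cvgn (series u).
Proof.
move=> uk kK; apply: normed_cvg.
apply: (@series_le_cvg _ _ k) => //.
- by move=> n; exact: normr_ge0.
- by move=> n; apply: le_trans (uk n).
- by apply: bounded_series_cvg kK => m; apply: le_trans (uk m).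
Qed.

(* [N K f] reads "the norm of [f] is at most [K]" in a Banach algebra of real
   functions on [D] whose norm dominates the sup norm; [function_class_series]
   is completeness. *)
Record function_class (R : realType) (T : Type) (D : set T)
    (N : R -> (T -> R) -> Prop) : Prop := FunctionClass {
  function_class_ge0 : forall K f, N K f -> 0 <= K;
  function_class_bound : forall K f, N K f -> forall t, D t -> `|f t| <= K;
  function_class_cst : forall c, N `|c| (fun=> c);
  function_class_mul : forall K K' f f', N K f -> N K' f' ->
    N (K * K') (fun t => f t * f' t);
  function_class_series : forall K f (k : R^nat) (F : nat -> T -> R),
    (forall j, N (k j) (F j)) -> (forall n, series k n <= K) ->
    (forall t, D t -> series (fun j => F j t) @ \oo --> f t) -> N K f }.

(** Monotonicity in the bound, and the fact that only the values on [D] matter, both follow from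
    completeness applied to a series with a single non-zero term. *)
Lemma function_class_le (R : realType) (T : Type) (D : set T)
    (N : R -> (T -> R) -> Prop) (NC : function_class D N) (K K' : R)
    (f f' : T -> R) :
  N K f -> K <= K' -> (forall t, D t -> f t = f' t) -> N K' f'.
Proof.
move=> NKf KK' ff'.
pose k (j : nat) := if j == 0%N then K else 0.
pose F (j : nat) := if j == 0%N then f else fun=> 0.
have seriesS (u : R^nat) : (forall j, u j.+1 = 0) ->
    forall n, series u n.+1 = u 0%N.
  by move=> u0 n; rewrite /series /= big_nat_recl// big1 ?addr0.
apply: (function_class_series NC (k := k) (F := F)).
- by case=> [|j] //; rewrite /k /F /= -[X in N X](normr0 R); exact: (function_class_cst NC).
- case=> [|n]; last by rewrite seriesS.
  by rewrite /series /= big_geq//; apply: le_trans KK'; exact: (function_class_ge0 NC NKf).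
- move=> t Dt; rewrite -cvg_shiftS /=.
  under eq_cvg do rewrite seriesS//.
  by rewrite /F /= ff'//; exact: cvg_cst.
Qed.

(** Likewise a consequence of completeness: a sum is a series with two non-zero terms. *)
Lemma function_class_add (R : realType) (T : Type) (D : set T)
    (N : R -> (T -> R) -> Prop) (NC : function_class D N) (K K' : R)
    (f f' : T -> R) :
  N K f -> N K' f' -> N (K + K') (fun t => f t + f' t).
Proof.
move=> NKf NKf'.
pose k (j : nat) := if j is j'.+1 then if j' is 0%N then K' else 0 else K.
pose F (j : nat) := if j is j'.+1 then if j' is 0%N then f' else fun=> 0 else f.
have seriesS (u : R^nat) : (forall j, u j.+2 = 0) ->
    forall n, series u n.+2 = u 0%N + u 1%N.
  by move=> u0 n; rewrite /series /= !big_nat_recl// big1 ?addr0.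
have K0 := function_class_ge0 NC NKf.
have K'0 := function_class_ge0 NC NKf'.
apply: (function_class_series NC (k := k) (F := F)).
- by case=> [|[|j]] //; rewrite /k /F /= -[X in N X](normr0 R); exact: (function_class_cst NC).
- case=> [|[|n]]; last by rewrite seriesS.
    by rewrite /series /= big_geq// addr_ge0.
  by rewrite /series /= big_nat1 lerDl.
- move=> t Dt; rewrite -(cvg_shiftn 2) /=.
  under eq_cvg => n do rewrite addn2 seriesS//.
  exact: cvg_cst.
Qed.

Lemma function_class_sum (R : realType) (T : Type) (D : set T)
    (N : R -> (T -> R) -> Prop) (NC : function_class D N) (I : Type)
    (r : seq I) (P : pred I) (k : I -> R) (F : I -> T -> R) :
  (forall i, P i -> N (k i) (F i)) ->
  N (\sum_(i <- r | P i) k i) (fun t => \sum_(i <- r | P i) F i t).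
Proof.
move=> NF; elim: r => [|i r IHr].
  rewrite big_nil; under boolp.eq_fun do rewrite big_nil.
  by rewrite -[X in N X](normr0 R); exact: (function_class_cst NC).
have -> : (fun t => \sum_(j <- i :: r | P j) F j t) =
    (fun t => if P i then F i t + \sum_(j <- r | P j) F j t
              else \sum_(j <- r | P j) F j t).
  by apply/boolp.funext => t; rewrite big_cons.
rewrite big_cons; case: ifP => // Pi.
by apply: (function_class_add NC) => //; exact: NF.
Qed.

Lemma function_class_prod (R : realType) (T : Type) (D : set T)
    (N : R -> (T -> R) -> Prop) (NC : function_class D N) (I : Type)
    (r : seq I) (P : pred I) (k : I -> R) (F : I -> T -> R) :
  (forall i, P i -> N (k i) (F i)) ->
  N (\prod_(i <- r | P i) k i) (fun t => \prod_(i <- r | P i) F i t).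
Proof.
move=> NF; elim: r => [|i r IHr].
  rewrite big_nil; under boolp.eq_fun do rewrite big_nil.
  by rewrite -[X in N X](normr1 R); exact: (function_class_cst NC).
have -> : (fun t => \prod_(j <- i :: r | P j) F j t) =
    (fun t => if P i then F i t * \prod_(j <- r | P j) F j t
              else \prod_(j <- r | P j) F j t).
  by apply/boolp.funext => t; rewrite big_cons.
rewrite big_cons; case: ifP => // Pi.
by apply: (function_class_mul NC) => //; exact: NF.
Qed.

Lemma function_class_exp (R : realType) (T : Type) (D : set T)
    (N : R -> (T -> R) -> Prop) (NC : function_class D N) (K : R)
    (f : T -> R) (n : nat) :
  N K f -> N (K ^+ n) (fun t => f t ^+ n).
Proof.
move=> NKf; elim: n => [|n IHn].
  by rewrite expr0 -[X in N X](normr1 R); exact: (function_class_cst NC).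
by rewrite exprS; under boolp.eq_fun do rewrite exprS; exact: (function_class_mul NC).
Qed.

Lemma function_class_scale (R : realType) (T : Type) (D : set T)
    (N : R -> (T -> R) -> Prop) (NC : function_class D N) (K c : R)
    (f : T -> R) :
  N K f -> N (`|c| * K) (fun t => c * f t).
Proof. by move=> NKf; apply: (function_class_mul NC) => //; exact: (function_class_cst NC). Qed.

Definition bounded_by (R : realType) (T : Type) (D : set T) (K : R)
    (f : T -> R) : Prop :=
  0 <= K /\ forall t, D t -> `|f t| <= K.

(** The base algebra, with the sup norm. Over a one-point domain it turns statements about all
    algebras into pointwise estimates. *)
Lemma bounded_by_class (R : realType) (T : Type) (D : set T) :
  function_class D (@bounded_by R T D).
Proof.
split.
- by move=> K f [].
- by move=> K f [].
- by move=> c; split.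
- move=> K K' f f' [K0 Kf] [K'0 Kf']; split; first exact: mulr_ge0.
  by move=> t Dt; rewrite normrM ler_pM ?Kf ?Kf'.
- move=> K f k F kF kK Ff; split.
    (* The empty partial sum is [0], so a bound on all partial sums is non-negative. *)
    by apply: le_trans (kK 0%N); rewrite /series /= big_geq.
  move=> t Dt; apply: cvg_norm_le (Ff t Dt) _ => n.
  by apply: le_trans (kK n); apply: ler_norm_series => m; case: (kF m) => _; exact.
Qed.

(** For [m >= M] one has [|s|^m <= sigma^m * (|s| / sigma)^M], so the tail inherits the bound [K]
    times a geometric factor. The Taylor estimates below are the cases of small [M]. *)
Lemma power_series_tail (R : realType) (e k : R^nat) (K sigma s l : R) (M : nat) :
  (forall m, `|e m| <= k m) -> 0 < sigma ->
  (forall n, series (fun m => k m * sigma ^+ m) n <= K) ->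
  `|s| <= sigma -> series (fun m => e m * s ^+ m) @ \oo --> l ->
  `|l - series (fun m => e m * s ^+ m) M| <= K * (`|s| / sigma) ^+ M.
Proof.
move=> ek sigma0 kK ssigma el.
have k0 m : 0 <= k m by apply: le_trans (ek m).
apply: (@cvg_norm_le _ (fun n => series (fun m => e m * s ^+ m) (n + M)%N -
  series (fun m => e m * s ^+ m) M)).
  apply: cvgB; last exact: cvg_cst.
  by rewrite (cvg_shiftn M).
move=> n; rewrite sub_series_geq ?leq_addl//.
apply: le_trans (ler_norm_sum _ _ _) _.
apply: (@le_trans _ _ (\sum_(M <= m < n + M) k m * sigma ^+ m * (`|s| / sigma) ^+ M)).
  rewrite big_seq [leRHS]big_seq; apply: ler_sum => m.
  rewrite mem_index_iota => /andP[Mm _].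
  rewrite normrM normrX -mulrA ler_pM//.
  rewrite -(subnK Mm) !exprD -mulrA -exprMn mulrC mulrA.
  rewrite -mulrA mulrCA divff ?gt_eqF// mulr1 mulrC ler_wpM2r ?exprn_ge0//.
  by rewrite lerXn2r// nnegrE// ltW.
rewrite -mulr_suml ler_wpM2r//; first by rewrite exprn_ge0// divr_ge0// ltW.
apply: le_trans (kK (n + M)%N); rewrite /series /=.
rewrite [leRHS](@big_cat_nat _ _ _ M)//= ?leq_addl// lerDr sumr_ge0// => i _.
by rewrite mulr_ge0// exprn_ge0// ltW.
Qed.

(* Power series in a new variable with coefficients in [N]. Its coefficient of
   degree one is a derivative, so derivatives stay in [N]. *)
Definition ext_class (R : realType) (T : Type) (D : set T)
    (N : R -> (T -> R) -> Prop) (sigma K : R) (f : T * R -> R) : Prop :=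
  exists (e : nat -> T -> R) (k : R^nat), [/\ forall m, N (k m) (e m),
    forall n, series (fun m => k m * sigma ^+ m) n <= K &
    forall t s, D t -> `|s| < sigma ->
      series (fun m => e m t * s ^+ m) @ \oo --> f (t, s)].

Definition ext_dom (R : realType) (T : Type) (D : set T) (sigma : R) :
  set (T * R) := [set ts | D ts.1 /\ `|ts.2| < sigma].

(** Monomials generate the rest: degree [0] gives constants and lifted functions, degree [1] the new
    variable, and products are series of monomials. *)
Lemma ext_class_monomial (R : realType) (T : Type) (D : set T)
    (N : R -> (T -> R) -> Prop) (NC : function_class D N) (sigma K : R)
    (f : T -> R) (m : nat) : 0 < sigma -> N K f ->
  ext_class D N sigma (K * sigma ^+ m) (fun ts => f ts.1 * ts.2 ^+ m).
Proof.
move=> sigma0 NKf.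
have K0 := function_class_ge0 NC NKf.
exists (fun j => if j == m then f else fun=> 0), (fun j => if j == m then K else 0).
have single (a x : R) n : series (fun j => (if j == m then a else 0) * x ^+ j) n =
    if (m < n)%N then a * x ^+ m else 0.
  rewrite /series /=.
  under eq_bigr => j _.
    rewrite (_ : _ * _ = if j == m then a * x ^+ m else 0); first over.
    by case: eqP => [->|] //; rewrite mul0r.
  by rewrite -big_mkcond big_nat1_eq.
split.
- move=> j; case: eqP => // _; rewrite -[X in N X](normr0 R); exact: (function_class_cst NC).
- by move=> n; rewrite single; case: ifP => // _; rewrite mulr_ge0// exprn_ge0// ltW.
- move=> t s Dt _.
  have -> : (fun j => (if j == m then f else fun=> 0) t * s ^+ j) =
      (fun j => (if j == m then f t else 0) * s ^+ j).
    by apply/boolp.funext => j; case: eqP.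
  rewrite -(cvg_shiftn m.+1) /=.
  under eq_cvg do rewrite single addnS ltnS leq_addl.
  exact: cvg_cst.
Qed.

Lemma cvg_series_weighted (R : realType) (u : nat -> R^nat) (l x : R^nat)
    (n : nat) : (forall m, u m @ \oo --> l m) ->
  series (fun m => u m J * x m) n @[J --> \oo] -->
  series (fun m => l m * x m) n.
Proof.
move=> ul; rewrite /series /=; elim: n => [|n IHn].
  by under eq_cvg do rewrite big_geq//; rewrite big_geq//; exact: cvg_cst.
under eq_cvg do rewrite big_nat_recr//=.
rewrite big_nat_recr//=; apply: cvgD => //.
by apply: cvgM => //; exact: cvg_cst.
Qed.

Lemma exchange_series (R : realType) (u : nat -> nat -> R) (x : R^nat) (n J : nat) :
  series (fun m => series (fun j => u j m) J * x m) n =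
  series (fun j => series (fun m => u j m * x m) n) J.
Proof.
rewrite /series /=; under eq_bigr do rewrite mulr_suml.
by rewrite exchange_big.
Qed.

Lemma cvg_series_geometric (R : realType) (u : R^nat) (l K z : R) :
  0 <= z < 1 -> (forall M, `|l - series u M| <= K * z ^+ M) ->
  series u @ \oo --> l.
Proof.
move=> /andP[z0 z1] H; apply/cvgrPdist_le => e e0.
have : (fun M => K * z ^+ M) @ \oo --> K * 0.
  by apply: cvgM; [exact: cvg_cst|apply: cvg_expr; rewrite ger0_norm].
rewrite mulr0 => /cvgr0_norm_le /(_ _ e0); apply: filterS => M; apply: le_trans.
by apply: le_trans (H M) _; exact: ler_norm.
Qed.

(** The coefficients of the sum are the sums of the coefficients. The interchange of the two
    summations is justified by the tail bounds of the [F j]: they share the ratio [|s| / sigma],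
    hence can be added up over [j]. *)
Lemma ext_class_series (R : realType) (T : Type) (D : set T)
    (N : R -> (T -> R) -> Prop) (NC : function_class D N) (sigma : R)
    (sigma0 : 0 < sigma) (K : R) (f : T * R -> R) (k : R^nat)
    (F : nat -> T * R -> R) :
  (forall j, ext_class D N sigma (k j) (F j)) ->
  (forall n, series k n <= K) ->
  (forall ts, ext_dom D sigma ts -> series (fun j => F j ts) @ \oo --> f ts) ->
  ext_class D N sigma K f.
Proof.
move=> /boolp.choice[e /boolp.choice[q]] /= qP kK Ff.
have qN j m : N (q j m) (e j m) by have [] := qP j.
have q0 j m : 0 <= q j m by exact: (function_class_ge0 NC (qN j m)).
have qk j n : series (fun m => q j m * sigma ^+ m) n <= k j by have [] := qP j.
have ebound j m t : D t -> `|e j m t| <= q j m.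
  exact: (function_class_bound NC (qN j m)).
have eF j t s : D t -> `|s| < sigma ->
    series (fun m => e j m t * s ^+ m) @ \oo --> F j (t, s).
  by have [_ _] := qP j; exact.
(* One coefficient is controlled by its own term in the bound of [F j]: [q j m * sigma^m <= k j]. *)
have qle m n : series (fun j => q j m) n <= K / sigma ^+ m.
  rewrite ler_pdivlMr ?exprn_gt0//; apply: le_trans (kK n).
  rewrite /series /= mulr_suml; apply: ler_sum => j _.
  apply: le_trans (qk j m.+1); rewrite /series /= big_nat_recr//= lerDr.
  by rewrite sumr_ge0// => i _; rewrite mulr_ge0// exprn_ge0// ltW.
have qcvg m : cvgn (series (fun j => q j m)).
  by apply: bounded_series_cvg (qle m) => j.
have ecvg m t : D t -> cvgn (series (fun j => e j m t)).
  by move=> Dt; apply: dominated_series_cvg (qle m) => j; exact: ebound.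
exists (fun m t => limn (series (fun j => e j m t))),
  (fun m => limn (series (fun j => q j m))); split.
- move=> m; apply: (function_class_series NC (qN^~ m)) => [n|t Dt].
    by apply: nondecreasing_cvgn_le (qcvg m) n; exact: nondecreasing_series.
  exact: ecvg.
- move=> n; have : series (fun m => series (fun j => q j m) J * sigma ^+ m) n
      @[J --> \oo] --> series (fun m => limn (series (fun j => q j m)) * sigma ^+ m) n.
    by apply: cvg_series_weighted => m; exact: qcvg.
  move=> /ler_cvg_to/(_ (cvg_cst K)); apply; apply: nearW => J.
  rewrite exchange_series; apply: le_trans (kK J); exact: ler_sum.
- move=> t s Dt ssigma.
  apply: (@cvg_series_geometric _ _ _ K (`|s| / sigma)).
    by rewrite divr_ge0// 1?ltW//= ltr_pdivrMr// mul1r.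
  move=> M; apply: (@cvg_norm_le _ (fun J => series (fun j => F j (t, s)) J -
     series (fun m => series (fun j => e j m t) J * s ^+ m) M)).
    apply: cvgB; first exact: Ff.
    by apply: cvg_series_weighted => m; exact: ecvg.
  move=> J; rewrite exchange_series.
  have -> : series (fun j => F j (t, s)) J -
      series (fun j => series (fun m => e j m t * s ^+ m) M) J =
      series (fun j => F j (t, s) - series (fun m => e j m t * s ^+ m) M) J.
    by rewrite /series /= sumrB.
  apply: (@le_trans _ _ (series (fun j => k j * (`|s| / sigma) ^+ M) J)).
    apply: ler_norm_series => j.
    apply: power_series_tail (ebound j ^~ t ^~ Dt) sigma0 (qk j) (ltW ssigma) _.
    exact: eF.
  rewrite /series /= -mulr_suml ler_wpM2r ?exprn_ge0 ?divr_ge0// ?(ltW sigma0)//.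
  exact: kK.
Qed.

Lemma ext_class_class (R : realType) (T : Type) (D : set T)
    (N : R -> (T -> R) -> Prop) (NC : function_class D N) (sigma : R) :
  0 < sigma -> function_class (ext_dom D sigma) (ext_class D N sigma).
Proof.
move=> sigma0.
have mono K f m := @ext_class_monomial R T D N NC sigma K f m sigma0.
have ser := @ext_class_series R T D N NC sigma sigma0.
split=> //.
- by move=> K f [e [k [_ kK _]]]; apply: le_trans (kK 0%N); rewrite /series /= big_geq.
- move=> K f [e [k [kN kK ef]]] [t s] [/= Dt ssigma].
  apply: cvg_norm_le (ef t s Dt ssigma) _ => n.
  apply: le_trans (kK n); apply: ler_norm_series => m.
  rewrite normrM normrX ler_pM//; first exact: (function_class_bound NC (kN m)).
  by rewrite lerXn2r ?nnegrE ?(ltW sigma0) ?(ltW ssigma).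
- move=> c; have := mono _ _ 0%N (function_class_cst NC c).
  rewrite expr0 mulr1; under boolp.eq_fun do rewrite expr0 mulr1.
  by [].
- move=> K K' f f' [e [k [kN kK ef]]] [e' [k' [k'N k'K ef']]].
  have k0 m := function_class_ge0 NC (kN m).
  have K'0 : 0 <= K'.
    by apply: le_trans (k'K 0%N); rewrite /series /= big_geq.
  (* No Cauchy product is formed: completeness is used over the degrees [m] of [f] and, for each
     [m], over the degrees [j] of [f']. *)
  apply: (ser _ _ (fun m => k m * sigma ^+ m * K')
    (fun m ts => e m ts.1 * ts.2 ^+ m * f' ts)).
  + move=> m; apply: (ser _ _ (fun j => k m * k' j * sigma ^+ (m + j))
      (fun j ts => e m ts.1 * e' j ts.1 * ts.2 ^+ (m + j))).
    * by move=> j; apply: (mono _ (fun t => _ t * _ t)); exact: (function_class_mul NC).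
    * move=> n; rewrite /series /=.
      under eq_bigr do rewrite exprD mulrACA.
      rewrite -mulr_sumr ler_wpM2l ?k'K//.
      by rewrite mulr_ge0// exprn_ge0// ltW.
    * move=> [t s] [/= Dt ssigma].
      rewrite (_ : series _ = (fun n => e m t * s ^+ m *
          series (fun j => e' j t * s ^+ j) n)).
        by apply: cvgM; [exact: cvg_cst|exact: ef'].
      apply/boolp.funext => n; rewrite /series /= mulr_sumr.
      by apply: eq_bigr => j _; rewrite exprD mulrACA.
  + move=> n; rewrite /series /= -mulr_suml ler_wpM2r//; exact: kK.
  + move=> [t s] [/= Dt ssigma].
    rewrite (_ : series _ = (fun n => series (fun j => e j t * s ^+ j) n * f' (t, s))).
      by apply: cvgM; [exact: ef|exact: cvg_cst].
    by apply/boolp.funext => n; rewrite /series /= mulr_suml.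
Qed.

Lemma ext_class_lift (R : realType) (T : Type) (D : set T)
    (N : R -> (T -> R) -> Prop) (NC : function_class D N) (sigma K : R)
    (f : T -> R) : 0 < sigma -> N K f ->
  ext_class D N sigma K (fun ts => f ts.1).
Proof.
move=> sigma0 NKf; have := ext_class_monomial NC 0 sigma0 NKf.
by rewrite expr0 mulr1; under boolp.eq_fun do rewrite expr0 mulr1.
Qed.

Lemma ext_class_var (R : realType) (T : Type) (D : set T)
    (N : R -> (T -> R) -> Prop) (NC : function_class D N) (sigma : R) :
  0 < sigma -> ext_class D N sigma sigma snd.
Proof.
move=> sigma0; have := ext_class_monomial NC 1 sigma0 (function_class_cst NC 1).
rewrite normr1 mul1r expr1; congr (ext_class _ _ _ _ _).
by apply/boolp.funext => ts /=; rewrite mul1r expr1.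
Qed.

(** * Analytic germs *)

(** The terms that [box_sum] gains in passing from the box [[0,N)^n] to [[0,N+1)^n]; they make the
    box sums the partial sums of a series, to which completeness applies. *)
Definition shell_sum (R : realType) (n : nat) (c : ('I_n -> nat) -> R)
    (h : 'rV[R]_n) (N : nat) : R :=
  \sum_(a : {ffun 'I_n -> 'I_N.+1} | ~~ [forall i, (a i < N)%N])
    c (fun i => a i : nat) * \prod_(i < n) h 0 i ^+ a i.

Lemma sum_box_recr (V : nmodType) (n N : nat) (G : ('I_n -> nat) -> V) :
  \sum_(a : {ffun 'I_n -> 'I_N.+1}) G (fun i => a i : nat) =
  \sum_(a : {ffun 'I_n -> 'I_N}) G (fun i => a i : nat) +
  \sum_(a : {ffun 'I_n -> 'I_N.+1} | ~~ [forall i, (a i < N)%N])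
    G (fun i => a i : nat).
Proof.
rewrite (bigID (fun a : {ffun 'I_n -> 'I_N.+1} => [forall i, (a i < N)%N])) /=.
congr (_ + _).
pose h (a : {ffun 'I_n -> 'I_N}) : {ffun 'I_n -> 'I_N.+1} :=
  [ffun i => widen_ord (leqnSn N) (a i)].
have h_inj : injective h.
  move=> a b /ffunP ab; apply/ffunP => i; apply: val_inj.
  by have /(congr1 val) := ab i; rewrite !ffunE.
transitivity (\sum_(a in h @: [set: {ffun 'I_n -> 'I_N}]%SET) G (fun i => a i : nat)).
  apply: eq_bigl => a; apply/forallP/imsetP => [aN|[b _ ->] i]; last first.
    by rewrite ffunE /=; exact: ltn_ord.
  exists [ffun i => Ordinal (aN i)]; rewrite ?inE//.
  by apply/ffunP => i; apply: val_inj; rewrite !ffunE.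
rewrite big_imset /=; last by move=> a b _ _; exact: h_inj.
rewrite big_mkcond; apply: eq_bigr => a _; rewrite inE; congr G.
by apply/boolp.funext => i; rewrite ffunE.
Qed.

(** The correction [box_sum c h 0] is an empty sum unless [n = 0], when the empty box still contains
    the empty multi-index. *)
Lemma box_sum_shells (R : realType) (n : nat) (c : ('I_n -> nat) -> R)
    (h : 'rV[R]_n) (N : nat) :
  series (shell_sum c h) N = box_sum c h N - box_sum c h 0.
Proof.
rewrite /series /=; elim: N => [|N IHN]; first by rewrite big_geq// subrr.
rewrite big_nat_recr//= IHN addrAC; congr (_ - _).
by rewrite /box_sum (sum_box_recr _ (fun a => c a * \prod_i h 0 i ^+ a i)).
Qed.

Lemma norm_row_le (R : realType) (n : nat) (h : 'rV[R]_n) (r : R) :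
  0 <= r -> (forall i, `|h 0 i| <= r) -> `|h| <= r.
Proof.
move=> r0 hr; rewrite [leLHS]/Num.Def.normr/= mx_normrE (bigmax_le _ r0)//=.
by move=> [i j] _; rewrite (ord1 i).
Qed.

Lemma norm_coord_le (R : realType) (n : nat) (h : 'rV[R]_n) (i : 'I_n) :
  `|h 0 i| <= `|h|.
Proof.
rewrite [leRHS]/Num.Def.normr/= mx_normrE.
exact: (le_bigmax _ (fun ij => `|h ij.1 ij.2|) (0, i)).
Qed.

(* Analyticity at [x0], in the form of the composition theorem: [F] can be
   substituted into every Banach algebra of functions. *)
Definition analytic_germ (R : realType) (n : nat) (F : 'rV[R]_n -> R)
    (x0 : 'rV[R]_n) : Prop :=
  exists rho K : R, 0 < rho /\
    forall (T : Type) (D : set T) (N : R -> (T -> R) -> Prop),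
    function_class D N -> forall gamma : T -> 'rV[R]_n,
    (forall i, N rho (fun t => gamma t 0 i - x0 0 i)) ->
    N K (fun t => F (gamma t)).

(** In any algebra the term of multi-index [a] has norm at most [|c a| * rho^|a|], so the series of
    absolute values at the corner [x0 + (rho, ..., rho)] bounds the substituted series. *)
Lemma analytic_at_germ (R : realType) (n : nat) (F : 'rV[R]_n -> R)
    (x0 : 'rV[R]_n) : analytic_at F x0 -> analytic_germ F x0.
Proof.
move=> [r [r0 [c cF]]].
(* Smaller than [r], so that the corner itself lies in the domain of convergence. *)
pose rho := r / 2.
have rho0 : 0 < rho by rewrite divr_gt0.
have rhor : rho < r by rewrite /rho ltr_pdivrMr// ltr_pMr// ltr1n.
pose absc := fun a : 'I_n -> nat => `|c a|.
pose h0 : 'rV[R]_n := const_mx rho.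
have absc_cvg : cvgn (box_sum absc h0).
  have [|+ _] := cF (x0 + h0).
    rewrite addrAC subrr add0r; apply: le_lt_trans rhor.
    by apply: norm_row_le => [|i]; rewrite ?mxE ?gtr0_norm// ltW.
  rewrite addrAC subrr add0r (_ : map_mx _ _ = h0)//.
  by apply/rowP => i; rewrite !mxE gtr0_norm.
have shell0 M : 0 <= shell_sum absc h0 M.
  apply: sumr_ge0 => a _; apply: mulr_ge0; [exact: normr_ge0|apply: prodr_ge0 => i _].
  by rewrite mxE exprn_ge0// ltW.
have box_le M : box_sum absc h0 M <= limn (box_sum absc h0).
  apply: nondecreasing_cvgn_le absc_cvg M; apply/nondecreasing_seqP => M.
  have e1 := box_sum_shells absc h0 M; have e2 := box_sum_shells absc h0 M.+1.
  move: e2 (shell0 M); rewrite seriesSr e1 => {e1}; lra.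
exists rho, (limn (box_sum absc h0)); split=> // T D N NC gamma gammaN.
have termN (a : 'I_n -> nat) :
    N (absc a * \prod_i h0 0 i ^+ a i)
      (fun t => c a * \prod_i (gamma t - x0) 0 i ^+ a i).
  apply: (function_class_scale NC).
  rewrite (_ : (fun t => _) =
    (fun t => \prod_i (gamma t 0 i - x0 0 i) ^+ a i)); last first.
    by apply/boolp.funext => t; apply: eq_bigr => i _; rewrite !mxE.
  apply: (function_class_prod NC _
    (F := fun i t => (gamma t 0 i - x0 0 i) ^+ a i)) => i _.
  by rewrite mxE; exact: (function_class_exp NC).
have boxN : N (box_sum absc h0 0) (fun t => box_sum c (gamma t - x0) 0).
  exact: (function_class_sum NC _ (F := fun (a : {ffun 'I_n -> 'I_0}) t =>
    c (fun i => a i : nat) * \prod_i (gamma t - x0) 0 i ^+ a i)).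
have shellN j : N (shell_sum absc h0 j) (fun t => shell_sum c (gamma t - x0) j).
  exact: (function_class_sum NC _ (F := fun (a : {ffun 'I_n -> 'I_j.+1}) t =>
    c (fun i => a i : nat) * \prod_i (gamma t - x0) 0 i ^+ a i)).
have restN : N (limn (box_sum absc h0) - box_sum absc h0 0)
    (fun t => F (gamma t) - box_sum c (gamma t - x0) 0).
  apply: (function_class_series NC shellN) => [M|t Dt].
    by rewrite box_sum_shells lerD2r.
  rewrite (_ : series _ = (fun M => box_sum c (gamma t - x0) M -
    box_sum c (gamma t - x0) 0)); last first.
    by apply/boolp.funext => M; rewrite -box_sum_shells.
  apply: cvgB; last exact: cvg_cst.
  apply: (cF _ _).2; apply: le_lt_trans rhor; apply: norm_row_le; first exact: ltW.
  by move=> i; rewrite !mxE; exact: (function_class_bound NC (gammaN i)).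
apply: (function_class_le NC (function_class_add NC restN boxN)).
  by rewrite subrK.
by move=> t _; rewrite subrK.
Qed.

(** Power series yield derivatives in this form: a linear term and a quadratic remainder whose
    constant is irrelevant. *)
Lemma is_derive_quadratic (R : realType) (V : normedModType R) (F : V -> R)
    (x v : V) (l sigma C : R) : 0 < sigma ->
  (forall s, `|s| < sigma -> `|F (x + s *: v) - F x - l * s| <= C * s ^+ 2) ->
  is_derive x v F l.
Proof.
move=> sigma0 FC.
have dF : h^-1 *: (F (h *: v + x) - F x) @[h --> 0^'] --> l.
  apply/cvgrPdist_le => e e0.
  have C1 : 0 < `|C| + 1 by rewrite ltr_wpDl.
  have de : 0 < e / (`|C| + 1) by rewrite divr_gt0.
  near=> s.
  have s0 : s != 0 by near: s; exact: nbhs_dnbhs_neq.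
  have ssigma : `|s| < sigma by near: s; exact: dnbhs0_lt.
  have sde : `|s| < e / (`|C| + 1) by near: s; exact: dnbhs0_lt.
  have sgt : 0 < `|s| by rewrite normr_gt0.
  rewrite -(ler_pM2l sgt) -normrM.
  have -> : s * (l - s^-1 *: (F (s *: v + x) - F x)) =
      - (F (x + s *: v) - F x - l * s).
    by rewrite mulrBr (addrC (s *: v)) /GRing.scale /= mulVKf//; ring.
  rewrite normrN; apply: le_trans (FC s ssigma) _.
  rewrite -[s ^+ 2]ger0_norm ?sqr_ge0// normrX expr2 mulrCA ler_wpM2l//.
  rewrite ltr_pdivlMr// mulrC in sde.
  apply: le_trans (ltW sde); rewrite ler_wpM2r//.
  by apply: le_trans (ler_norm C) _; rewrite lerDl.
by apply: DeriveDef; [apply/cvg_ex; exists l|apply/cvg_lim].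
Unshelve. all: by end_near. Qed.

(** Substitute [gamma + s *: b] in the algebra with the variable [s] adjoined: [e] is the
    coefficient of degree one, hence an element of [N], and the remainder is the tail from degree
    two. The constants do not depend on the algebra, nor on [gamma] and [b]. *)
Lemma analytic_germ_taylor1 (R : realType) (n : nat) (F : 'rV[R]_n -> R)
    (x0 : 'rV[R]_n) (B : R) : analytic_germ F x0 -> 0 < B ->
  exists rho sigma C : R, [/\ 0 < rho, 0 < sigma, 0 <= C &
    forall (T : Type) (D : set T) (N : R -> (T -> R) -> Prop),
    function_class D N -> forall gamma b : T -> 'rV[R]_n,
    (forall i, N rho (fun t => gamma t 0 i - x0 0 i)) ->
    (forall i, N B (fun t => b t 0 i)) ->
    exists2 e : T -> R, N C e &
    forall t s, D t -> `|s| < sigma ->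
      `|F (gamma t + s *: b t) - F (gamma t) - e t * s| <= C * s ^+ 2].
Proof.
move=> [rho [K [rho0 FK]]] B0.
have K0 : 0 <= K.
  have NC := @bounded_by_class R unit setT.
  apply: (function_class_ge0 NC (FK _ _ _ NC (fun=> x0) _)) => i.
  by split=> [|t _]; rewrite ?subrr ?normr0 ltW.
have rho2 : 0 < rho / 2 by rewrite divr_gt0.
(* Half of [rho] is allotted to [gamma - x0], the other half to [s *: b]. *)
pose sigma := rho / 2 / B.
have sigma0 : 0 < sigma by rewrite divr_gt0.
have sigma2 : 0 < sigma ^+ 2 by rewrite exprn_gt0.
(* The first summand bounds the coefficient [e], the second the remainder. *)
pose C := K / sigma + K / sigma ^+ 2.
have C0 : 0 <= C by rewrite addr_ge0// divr_ge0// ltW.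
exists (rho / 2), sigma, C; split => // T D N NC gamma b gammaN bN.
have EC := ext_class_class NC sigma0.
have [i|e [k [ek kK eF]]] := FK _ _ _ EC (fun ts => gamma ts.1 + ts.2 *: b ts.1).
  have := function_class_add EC (ext_class_lift NC sigma0 (gammaN i))
    (function_class_mul EC (ext_class_var NC sigma0) (ext_class_lift NC sigma0 (bN i))).
  move/(function_class_le EC); apply; last first.
    by move=> [t s] _ /=; rewrite !mxE addrAC.
  by rewrite /sigma divfK ?gt_eqF//; lra.
have k0 m := function_class_ge0 NC (ek m).
exists (e 1%N).
  apply: (function_class_le NC (ek 1%N)) => //.
  apply: (@le_trans _ _ (K / sigma)); last by rewrite lerDl divr_ge0// ltW.
  rewrite ler_pdivlMr//; apply: le_trans (kK 2%N).
  by rewrite /series /= big_nat_recr//= expr1 lerDr big_nat1 mulr_ge0.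
move=> t s Dt ssigma.
have e0 : e 0%N t = F (gamma t).
  have := eF t 0 Dt; rewrite normr0 => /(_ sigma0) /=.
  rewrite scale0r addr0 -cvg_shiftS /=.
  under eq_cvg => j.
    rewrite (_ : series _ _ = e 0%N t); first over.
    rewrite /series /= big_nat_recl// expr0 mulr1 big1 ?addr0// => i _.
    by rewrite exprS mul0r mulr0.
  move=> h; apply: (cvg_unique _ (cvg_cst _) h); exact: Rhausdorff.
have := power_series_tail 2 (fun m => function_class_bound NC (ek m) Dt)
  sigma0 kK (ltW ssigma) (eF t s Dt ssigma).
rewrite {1}/series /= !big_nat_recr//= big_geq// add0r expr0 mulr1 expr1 e0.
rewrite opprD addrA => /le_trans; apply.
rewrite expr_div_n mulrA -normrX ger0_norm ?sqr_ge0// mulrAC ler_wpM2r ?sqr_ge0//.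
by rewrite lerDr divr_ge0// ltW.
Qed.

Lemma analytic_germ_taylor1_dir (R : realType) (n : nat) (F : 'rV[R]_n -> R)
    (x0 v : 'rV[R]_n) : analytic_germ F x0 ->
  exists rho sigma C : R, [/\ 0 < rho, 0 < sigma, 0 <= C &
    forall (T : Type) (D : set T) (N : R -> (T -> R) -> Prop),
    function_class D N -> forall gamma : T -> 'rV[R]_n,
    (forall i, N rho (fun t => gamma t 0 i - x0 0 i)) ->
    N C (fun t => 'D_v F (gamma t)) /\
    forall t s, D t -> `|s| < sigma ->
      `|F (gamma t + s *: v) - F (gamma t) - 'D_v F (gamma t) * s| <= C * s ^+ 2].
Proof.
move=> aF; have v1 : 0 < `|v| + 1 by rewrite ltr_wpDl.
have [rho [sigma [C [rho0 sigma0 C0 H]]]] := analytic_germ_taylor1 aF v1.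
exists rho, sigma, C; split=> // T D N NC gamma gammaN.
have [|e eC Fe] := H T D N NC gamma (fun=> v) gammaN.
  move=> i; apply: (function_class_le NC (function_class_cst NC (v 0 i))) => //.
  by apply: le_trans (norm_coord_le _ _) _; rewrite lerDl.
have eD t : D t -> 'D_v F (gamma t) = e t.
  move=> Dt; apply: (@derive_val _ _ _ _ _ _ _ _).
  by apply: (is_derive_quadratic sigma0) => s; exact: Fe.
split=> [|t s Dt]; last by rewrite eD//; exact: Fe.
by apply: (function_class_le NC eC) => // t Dt; rewrite eD.
Qed.

(** The degree-one coefficient lies in the algebra where the substitution was made, with a bound
    independent of that algebra, and this is what a germ is. *)
Lemma analytic_germ_derive (R : realType) (n : nat) (F : 'rV[R]_n -> R)
    (x0 v : 'rV[R]_n) : analytic_germ F x0 -> analytic_germ ('D_v F) x0.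
Proof.
move=> /(analytic_germ_taylor1_dir v)[rho [sigma [C [rho0 _ _ H]]]].
by exists rho, C; split => // T D N NC gamma /(H T D N NC gamma)[].
Qed.

(** The estimate is uniform in the base point [x]; additivity in the direction relies on this, since
    it compares derivatives at two nearby points. *)
Lemma analytic_germ_taylor1_point (R : realType) (n : nat) (F : 'rV[R]_n -> R)
    (x0 v : 'rV[R]_n) : analytic_germ F x0 ->
  exists delta C : R, [/\ 0 < delta, 0 <= C &
    forall x s, `|x - x0| < delta -> `|s| < delta ->
      `|F (x + s *: v) - F x - 'D_v F x * s| <= C * s ^+ 2].
Proof.
move=> /(analytic_germ_taylor1_dir v)[rho [sigma [C [rho0 sigma0 C0 H]]]].
exists (Num.min rho sigma), C; split=> //; first by rewrite lt_min rho0.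
move=> x s; rewrite !lt_min => /andP[xrho _] /andP[_ ssigma].
have [|_ Hs] := H unit setT _ (@bounded_by_class R unit setT) (fun=> x); last exact: (Hs tt).
move=> i; split; first exact: ltW.
move=> _ _; apply: ltW; apply: le_lt_trans xrho.
by have := norm_coord_le (x - x0) i; rewrite !mxE.
Qed.

Lemma analytic_germ_is_derive (R : realType) (n : nat) (F : 'rV[R]_n -> R)
    (x v : 'rV[R]_n) : analytic_germ F x -> is_derive x v F ('D_v F x).
Proof.
move=> /(analytic_germ_taylor1_point v)[delta [C [delta0 C0 H]]].
apply: (is_derive_quadratic delta0) => s; apply: H.
by rewrite subrr normr0.
Qed.

Lemma analytic_germ_deriveZ (R : realType) (n : nat) (F : 'rV[R]_n -> R)
    (x v : 'rV[R]_n) (a : R) : analytic_germ F x ->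
  'D_(a *: v) F x = a * 'D_v F x.
Proof.
move=> /(analytic_germ_taylor1_point v)[delta [C [delta0 C0 H]]].
have a1 : 0 < `|a| + 1 by rewrite ltr_wpDl.
apply: (@derive_val _ _ _ _ _ _ _ _).
apply: (@is_derive_quadratic _ _ _ _ _ _ (delta / (`|a| + 1)) (C * a ^+ 2)).
  by rewrite divr_gt0.
move=> s sd; have := H x (s * a); rewrite subrr normr0 => /(_ delta0).
have -> : C * a ^+ 2 * s ^+ 2 = C * (s * a) ^+ 2 by ring.
rewrite scalerA (_ : a * _ * s = 'D_v F x * (s * a)); [apply|ring].
rewrite normrM; rewrite ltr_pdivlMr// in sd; apply: le_lt_trans sd.
by rewrite ler_wpM2l// lerDl.
Qed.

(** Go from [x] to [x + s *: v], then on along [w]. The second increment involves ['D_w F] at the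
    moved point, which differs from its value at [x] by [O(s)] because ['D_w F] is again a germ. *)
Lemma analytic_germ_deriveD (R : realType) (n : nat) (F : 'rV[R]_n -> R)
    (x v w : 'rV[R]_n) : analytic_germ F x ->
  'D_(v + w) F x = 'D_v F x + 'D_w F x.
Proof.
move=> aF.
have [d1 [C1 [d10 C10 H1]]] := analytic_germ_taylor1_point v aF.
have [d2 [C2 [d20 C20 H2]]] := analytic_germ_taylor1_point w aF.
have [d3 [C3 [d30 C30 H3]]] :=
  analytic_germ_taylor1_point v (analytic_germ_derive w aF).
set L := 'D_v ('D_w F) x in H3.
have v1 : 0 < `|v| + 1 by rewrite ltr_wpDl.
apply: (@derive_val _ _ _ _ _ _ _ _).
apply: (@is_derive_quadratic _ _ _ _ _ _
  (Num.min 1 (Num.min d1 (Num.min d3 (Num.min d2 (d2 / (`|v| + 1))))))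
  (C1 + C2 + (`|L| + C3))).
  by rewrite !lt_min ltr01 d10 d20 d30 divr_gt0.
move=> s; rewrite !lt_min => /and5P[s1 sd1 sd3 sd2 sdv].
have {}H1 := H1 x s; rewrite subrr normr0 in H1; have {H1} := H1 d10 sd1.
have {}H3 := H3 x s; rewrite subrr normr0 in H3; have {H3} := H3 d30 sd3.
have {H2} := H2 (x + s *: v) s; rewrite addrAC subrr add0r.
rewrite normrZ; rewrite ltr_pdivlMr// in sdv.
have sv : `|s| * `|v| < d2 by apply: le_lt_trans sdv; rewrite ler_wpM2l// lerDl.
move=> /(_ sv sd2); rewrite (_ : x + s *: v + s *: w = x + s *: (v + w));
  last by rewrite scalerDr addrA.
set a := F (x + s *: (v + w)); set b := F (x + s *: v).
set p := 'D_w F (x + s *: v); rewrite -/L => Ha Hp Hb.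
have s0 : 0 <= `|s| by [].
have -> : a - F x - ('D_v F x + 'D_w F x) * s =
  (a - b - p * s) + (b - F x - 'D_v F x * s) + (p - 'D_w F x) * s by ring.
have Hc : `|(p - 'D_w F x) * s| <= (`|L| + C3) * s ^+ 2.
  rewrite normrM -[s ^+ 2]ger0_norm ?sqr_ge0// normrX expr2 mulrA ler_wpM2r//.
  have -> : p - 'D_w F x = (p - 'D_w F x - L * s) + L * s by ring.
  apply: le_trans (ler_normD _ _) _; rewrite addrC mulrDl normrM lerD2l.
  apply: le_trans Hp _; rewrite ler_wpM2l// -[s ^+ 2]ger0_norm ?sqr_ge0//.
  by rewrite normrX expr2 ler_piMr// ltW.
apply: le_trans (ler_normD _ _) _; apply: (le_trans (lerD (ler_normD _ _) (lexx _))).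
apply: le_trans (lerD (lerD Ha Hb) Hc) _; lra.
Qed.

Lemma analytic_germ_derive_sum (R : realType) (n : nat) (F : 'rV[R]_n -> R)
    (x v : 'rV[R]_n) : analytic_germ F x ->
  'D_v F x = \sum_i v 0 i * 'D_(delta_mx 0 i) F x.
Proof.
move=> aF; rewrite {1}[v]row_sum_delta.
elim/big_ind2: _ => [||i _].
- by rewrite derive0.
- by move=> a1 a2 b1 b2 <- <-; rewrite analytic_germ_deriveD.
- by rewrite analytic_germ_deriveZ.
Qed.

(** The parameter space is the unit ball of directions, with [b] the identity, so that one constant
    serves for all directions: Frechet differentiability with a quadratic remainder. *)
Lemma analytic_germ_taylor1_ball (R : realType) (n : nat) (F : 'rV[R]_n -> R)
    (x : 'rV[R]_n) : analytic_germ F x ->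
  exists delta C : R, [/\ 0 < delta, 0 <= C &
    forall h, `|h| < delta -> `|F (x + h) - F x - 'D_h F x| <= C * `|h| ^+ 2].
Proof.
move=> aF; have [rho [sigma [C [rho0 sigma0 C0 H]]]] := analytic_germ_taylor1 aF ltr01.
pose D : set 'rV[R]_n := [set v | `|v| <= 1].
have [i|i|e [_ eC] Fe] := H _ D _ (@bounded_by_class R _ D) (fun=> x) id.
- by split=> [|t _]; rewrite ?subrr ?normr0 ltW.
- by split=> // t Dt; apply: le_trans Dt; exact: norm_coord_le.
have eD v : D v -> 'D_v F x = e v.
  move=> Dv; apply: (@derive_val _ _ _ _ _ _ _ _).
  by apply: (is_derive_quadratic sigma0) => s; exact: Fe.
exists sigma, C; split=> // h hs.
have [->|h0] := eqVneq h 0.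
  by rewrite addr0 subrr derive0 subrr normr0 mulr_ge0.
have hn : `|h| != 0 by rewrite normr_eq0.
have Du : D (`|h|^-1 *: h) by rewrite /D /= normrZ normfV normr_id mulVf.
have := Fe _ `|h| Du; rewrite normr_id -eD// scalerA divff// scale1r => /(_ hs).
by rewrite analytic_germ_deriveZ// mulrAC mulVf// mul1r.
Qed.

Lemma finite_positive_lower_bound (R : realType) (m : nat) (d : 'I_m -> R) :
  (forall i, 0 < d i) -> exists2 e, 0 < e & forall i, e <= d i.
Proof.
move=> d0; exists (\big[Num.min/1]_i d i).
  by apply/bigmin_gtP; split => // i _; exact: d0.
by move=> i; exact: bigmin_le_cond.
Qed.

(** The increment of [X] is [h = s *: a + r] with [|r| <= B * s^2]. The remainder of [F] at [h] is
    quadratic in [s], and ['D_r F] is at most [M * |r|]. *)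
Lemma analytic_germ_chain (R : realType) (n m : nat) (F : 'rV[R]_m -> R)
    (X : 'rV[R]_n -> 'rV[R]_m) (q w : 'rV[R]_n) :
  analytic_germ F (X q) -> (forall i, analytic_germ (fun x => X x 0 i) q) ->
  is_derive q w (fun x => F (X x)) ('D_(\row_i 'D_w (fun x => X x 0 i) q) F (X q)).
Proof.
move=> aF aX; set a := \row_i _.
have [d [A [d0 A0 FA]]] := analytic_germ_taylor1_ball aF.
have /boolp.choice[dX /boolp.choice[C dC]] := fun i => analytic_germ_taylor1_point w (aX i).
pose B := \sum_i C i.
pose M := \sum_i `|'D_(delta_mx 0 i) F (X q)|.
have C0 i : 0 <= C i by have [] := dC i.
have CB i : C i <= B.
  by rewrite /B (bigD1 i)//= lerDl sumr_ge0.
have B0 : 0 <= B by exact: sumr_ge0.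
have aB0 : 0 < `|a| + B + 1 by rewrite ltr_wpDl// addr_ge0.
have [|e e0 eX] := @finite_positive_lower_bound _ _ dX.
  by move=> i; have [] := dC i.
apply: (@is_derive_quadratic _ _ _ _ _ _
  (Num.min e (Num.min 1 (d / (`|a| + B + 1))))
  (A * (`|a| + B) ^+ 2 + M * B)).
  by rewrite !lt_min e0 ltr01 divr_gt0.
move=> s; rewrite !lt_min => /and3P[se s1 sd].
have {}se i : `|s| < dX i by exact: lt_le_trans (eX i).
pose h := X (q + s *: w) - X q.
pose r := h - s *: a.
have rB : `|r| <= B * s ^+ 2.
  apply: norm_row_le => [|i]; first by rewrite mulr_ge0// sqr_ge0.
  have [dXi0 _ /(_ q s)] := dC i; rewrite subrr normr0 => /(_ dXi0 (se i)).
  rewrite !mxE [s * _]mulrC => /le_trans; apply.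
  by rewrite ler_wpM2r// sqr_ge0.
have s2 : s ^+ 2 <= `|s|.
  by rewrite -[s ^+ 2]ger0_norm ?sqr_ge0// normrX expr2 ler_piMr// ltW.
have hs : `|h| <= (`|a| + B) * `|s|.
  have -> : h = s *: a + r by rewrite /r addrC subrK.
  apply: le_trans (ler_normD _ _) _; rewrite normrZ mulrDl mulrC lerD2l.
  by apply: le_trans rB _; rewrite ler_wpM2l.
have hd : `|h| < d.
  apply: le_lt_trans hs _; rewrite ltr_pdivlMr// mulrC in sd.
  by apply: le_lt_trans sd; rewrite ler_wpM2r// lerDl.
have := FA h hd; rewrite /= {1}/h [X q + _]addrC subrK => Fh.
have -> : F (X (q + s *: w)) - F (X q) - 'D_a F (X q) * s =
    F (X (q + s *: w)) - F (X q) - 'D_h F (X q) + 'D_r F (X q).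
  have -> : 'D_h F (X q) = s * 'D_a F (X q) + 'D_r F (X q).
    by rewrite -analytic_germ_deriveZ// -analytic_germ_deriveD// addrC subrK.
  by ring.
apply: le_trans (ler_normD _ _) _; rewrite mulrDl; apply: lerD.
  apply: le_trans Fh _; rewrite -mulrA ler_wpM2l//.
  rewrite -[s ^+ 2]ger0_norm ?sqr_ge0// normrX -exprMn.
  by rewrite lerXn2r// nnegrE// mulr_ge0// addr_ge0.
rewrite analytic_germ_derive_sum// -mulrA.
apply: le_trans (ler_norm_sum _ _ _) _; rewrite mulr_suml; apply: ler_sum => i _.
rewrite normrM mulrC ler_wpM2l//; apply: le_trans rB; exact: norm_coord_le.
Unshelve. all: by end_near. Qed.

(** * Analytic functions of one real variable *)

Definition ps_class (R : realType) : R -> R -> (unit * R -> R) -> Prop :=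
  ext_class setT (@bounded_by R unit setT).

Lemma ps_class_class (R : realType) (sigma : R) : 0 < sigma ->
  function_class (ext_dom setT sigma) (ps_class sigma).
Proof. exact/ext_class_class/bounded_by_class. Qed.

Definition analytic1 (R : realType) (phi : R -> R) : Prop :=
  exists sigma K : R, 0 < sigma /\ ps_class sigma K (fun ts => phi ts.2).

Lemma ps_class_shrink (R : realType) (sigma tau K : R) f : 0 < tau <= sigma ->
  ps_class sigma K f -> ps_class tau K f.
Proof.
move=> /andP[tau0 taus] [e [k [ek kK ef]]]; exists e, k; split=> //.
  move=> n; apply: le_trans (kK n); apply: ler_sum => m _.
  have [k0 _] := ek m; rewrite ler_wpM2l// lerXn2r// nnegrE ltW//.
  exact: lt_le_trans taus.
by move=> t s Dt st; apply: ef => //; exact: lt_le_trans taus.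
Qed.

(** One bound holds for all small radii, so that several functions can be given a common radius. *)
Lemma analytic1_near (R : realType) (phi : R -> R) : analytic1 phi ->
  exists K, \forall sigma \near 0^'+, ps_class sigma K (fun ts => phi ts.2).
Proof.
move=> [sigma [K [sigma0 phiK]]]; exists K; near=> tau.
apply: (@ps_class_shrink _ sigma) => //; apply/andP; split; near: tau.
  exact: nbhs_right_gt.
exact: nbhs_right_le.
Unshelve. all: by end_near. Qed.

Lemma analytic1_expansion (R : realType) (phi : R -> R) : analytic1 phi ->
  exists (c : R^nat) (sigma K : R), [/\ 0 < sigma, 0 <= K &
    forall M t, `|t| < sigma ->
      `|phi t - series (fun m => c m * t ^+ m) M| <= K * (`|t| / sigma) ^+ M].
Proof.
move=> [sigma [K [sigma0 [e [k [ek kK ef]]]]]].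
exists (e ^~ tt), sigma, K; split=> //.
  by apply: le_trans (kK 0%N); rewrite /series /= big_geq.
move=> M t ts; apply: (power_series_tail _ _ sigma0 kK (ltW ts)).
  by move=> m; have [_ +] := ek m; exact.
exact: (ef tt).
Qed.

(** Without its constant term the series starts in degree one, so shrinking the radius from [sigma]
    to [tau] multiplies its norm by at most [tau / sigma]. This brings a curve within the radius
    [rho] that a germ prescribes for substitution. *)
Lemma analytic1_small (R : realType) (phi : R -> R) (rho : R) :
  analytic1 phi -> 0 < rho ->
  \forall sigma \near 0^'+, ps_class sigma rho (fun ts => phi ts.2 - phi 0).
Proof.
move=> aphi rho0.
have [sigma [K [sigma0 [e [k [ek kK ef]]]]]] := aphi.
have K0 : 0 <= K by apply: le_trans (kK 0%N); rewrite /series /= big_geq.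
have K1 : 0 < K + 1 by rewrite ltr_wpDl.
have bnd : 0 < sigma * rho / (K + 1) by rewrite divr_gt0// mulr_gt0.
near=> tau.
have tau0 : 0 < tau by near: tau; exact: nbhs_right_gt.
have taus : tau <= sigma by near: tau; exact: nbhs_right_le.
have taur : tau <= sigma * rho / (K + 1) by near: tau; exact: nbhs_right_le.
have e0 : e 0%N tt = phi 0.
  have := ef tt 0 I; rewrite normr0 => /(_ sigma0) /=; rewrite -cvg_shiftS /=.
  under eq_cvg => j.
    rewrite (_ : series _ _ = e 0%N tt); first over.
    rewrite /series /= big_nat_recl// expr0 mulr1 big1 ?addr0// => i _.
    by rewrite exprS mul0r mulr0.
  move=> h; apply: (cvg_unique _ (cvg_cst _) h); exact: Rhausdorff.
have k0 m : 0 <= k m by have [] := ek m.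
exists (fun m => if m is 0%N then fun=> 0 else e m),
  (fun m => if m is 0%N then 0 else k m); split.
- by case=> [|m]; [split => // ??; rewrite normr0|exact: ek].
- move=> n; apply: (@le_trans _ _ (tau / sigma * K)).
    apply: (@le_trans _ _ (tau / sigma * series (fun m => k m * sigma ^+ m) n)).
      rewrite /series /= mulr_sumr; apply: ler_sum => -[|m] _.
        by rewrite mul0r !mulr_ge0// ?invr_ge0 ltW.
      rewrite mulrCA ler_wpM2l// exprS -[sigma ^+ _]/(sigma ^+ m.+1).
      rewrite [sigma ^+ _]exprS mulrA divfK ?gt_eqF// ler_wpM2l ?(ltW tau0)//.
      by rewrite lerXn2r// nnegrE ltW.
    by rewrite ler_wpM2l// divr_ge0// ltW.
  rewrite mulrAC ler_pdivrMr// (le_trans (ler_wpM2r K0 taur))//.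
  rewrite mulrAC ler_pdivrMr// [rho * _]mulrC.
  by rewrite ler_wpM2l ?lerDl// mulr_ge0// ltW.
- move=> [] s _ st; rewrite -e0 -cvg_shiftS /=.
  under eq_cvg => j.
    rewrite (_ : series _ _ = series (fun m => e m tt * s ^+ m) j.+1 - e 0%N tt).
      over.
    rewrite /series /= !big_nat_recl//= mul0r add0r expr0 mulr1.
    by rewrite addrAC subrr add0r.
  apply: cvgB; last exact: cvg_cst.
  rewrite (cvg_shiftS (series _)); apply: ef => //; exact: lt_le_trans taus.
Unshelve. all: by end_near. Qed.

Lemma analytic1_comp (R : realType) (n : nat) (F : 'rV[R]_n -> R)
    (gamma : R -> 'rV[R]_n) : analytic_germ F (gamma 0) ->
  (forall i, analytic1 (fun t => gamma t 0 i)) -> analytic1 (fun t => F (gamma t)).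
Proof.
move=> [rho [K [rho0 FK]]] agamma.
have : \forall sigma \near 0^'+, 0 < sigma /\ forall i, ps_class sigma rho
    (fun ts => gamma ts.2 0 i - gamma 0 0 i).
  near=> sigma; split; first by near: sigma; exact: nbhs_right_gt.
  near: sigma; apply: (@filter_forall _ _ (fun i sigma => ps_class sigma rho
    (fun ts => gamma ts.2 0 i - gamma 0 0 i))) => i.
  exact: (analytic1_small (agamma i)).
move=> /filter_ex[sigma [sigma0 gs]]; exists sigma, K; split => //.
exact: (FK _ _ _ (ps_class_class sigma0) (fun ts => gamma ts.2)).
Unshelve. all: by end_near. Qed.

Lemma analytic1_eq (R : realType) (phi psi : R -> R) :
  (\forall t \near (0 : R), phi t = psi t) -> analytic1 phi -> analytic1 psi.
Proof.
move=> /nbhs_ballP[e /= e0 eq_e] /analytic1_near[K phiK].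
have : \forall sigma \near 0^'+, 0 < sigma <= e /\
    ps_class sigma K (fun ts => phi ts.2).
  near=> sigma; split; last by near: sigma.
  by apply/andP; split; near: sigma; [exact: nbhs_right_gt|exact: nbhs_right_le].
move=> /filter_ex[sigma [/andP[sigma0 se] ps]]; exists sigma, K; split => //.
apply: (function_class_le (ps_class_class sigma0) ps) => // -[u s] [_ /= ss].
by apply: eq_e; rewrite /ball /= sub0r normrN; exact: lt_le_trans se.
Unshelve. all: by end_near. Qed.

Lemma analytic1_cst (R : realType) (c : R) : analytic1 (fun=> c).
Proof. by exists 1, `|c|; split => //; exact: (function_class_cst (ps_class_class ltr01)). Qed.

Lemma analytic1_id (R : realType) : analytic1 (@id R).
Proof.
exists 1, 1; split => //; exact: (ext_class_var (@bounded_by_class R unit setT) ltr01).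
Qed.

Lemma analytic1_add (R : realType) (phi psi : R -> R) :
  analytic1 phi -> analytic1 psi -> analytic1 (fun t => phi t + psi t).
Proof.
move=> /analytic1_near[K phiK] /analytic1_near[K' psiK].
have /filter_ex[sigma [sigma0 [h h']]] : \forall sigma \near 0^'+, 0 < sigma /\
    (ps_class sigma K (fun ts => phi ts.2) /\ ps_class sigma K' (fun ts => psi ts.2)).
  near=> sigma; split; [|split]; near: sigma => //; exact: nbhs_right_gt.
exists sigma, (K + K'); split => //.
exact: (function_class_add (ps_class_class sigma0) h h').
Unshelve. all: by end_near. Qed.

Lemma analytic1_mul (R : realType) (phi psi : R -> R) :
  analytic1 phi -> analytic1 psi -> analytic1 (fun t => phi t * psi t).
Proof.
move=> /analytic1_near[K phiK] /analytic1_near[K' psiK].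
have /filter_ex[sigma [sigma0 [h h']]] : \forall sigma \near 0^'+, 0 < sigma /\
    (ps_class sigma K (fun ts => phi ts.2) /\ ps_class sigma K' (fun ts => psi ts.2)).
  near=> sigma; split; [|split]; near: sigma => //; exact: nbhs_right_gt.
exists sigma, (K * K'); split => //.
exact: (function_class_mul (ps_class_class sigma0) h h').
Unshelve. all: by end_near. Qed.

Lemma analytic1_opp (R : realType) (phi : R -> R) :
  analytic1 phi -> analytic1 (fun t => - phi t).
Proof.
move=> /(analytic1_mul (analytic1_cst (-1))); apply: analytic1_eq.
by near=> t; rewrite mulN1r.
Unshelve. all: by end_near. Qed.

Lemma analytic1_sum (R : realType) (I : Type) (r : seq I) (P : pred I)
    (phi : I -> R -> R) : (forall i, P i -> analytic1 (phi i)) ->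
  analytic1 (fun t => \sum_(i <- r | P i) phi i t).
Proof.
move=> aphi; elim: r => [|i r IHr].
  by under boolp.eq_fun do rewrite big_nil; exact: analytic1_cst.
have -> : (fun t => \sum_(j <- i :: r | P j) phi j t) =
    (fun t => if P i then phi i t + \sum_(j <- r | P j) phi j t
              else \sum_(j <- r | P j) phi j t).
  by apply/boolp.funext => t; rewrite big_cons.
by case Pi: (P i) => //; apply: analytic1_add => //; exact: aphi.
Qed.

Lemma analytic1_continuous (R : realType) (phi : R -> R) :
  analytic1 phi -> phi t @[t --> (0 : R)] --> phi 0.
Proof.
move=> /analytic1_expansion[c [sigma [K [sigma0 K0 cK]]]].
have c0 : phi 0 = c 0%N.
  have := cK 1%N 0; rewrite normr0 => /(_ sigma0).
  rewrite mul0r expr1 mulr0 normr_le0 subr_eq0 => /eqP ->.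
  by rewrite /series /= big_nat1 expr0 mulr1.
apply/cvgrPdist_le => e e0.
have bnd : 0 < sigma * e / (K + 1) by rewrite divr_gt0 ?mulr_gt0// ltr_wpDl.
near=> t.
have ts : `|t| < sigma by near: t; exact: (@nbhs0_lt R R).
have te : `|t| < sigma * e / (K + 1) by near: t; exact: (@nbhs0_lt R R).
rewrite distrC c0; have := cK 1%N t ts.
rewrite /series /= big_nat1 expr0 mulr1 expr1 => /le_trans; apply.
rewrite ltr_pdivlMr ?ltr_wpDl// in te.
rewrite mulrA ler_pdivrMr// [e * _]mulrC; apply: le_trans (ltW te).
by rewrite mulrC ler_wpM2l// lerDl.
Unshelve. all: by end_near. Qed.

(** * Odd order of a sign change *)

Lemma series_first_nonzero (R : realType) (c : R^nat) (t : R) (k : nat) :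
  (forall m, (m < k)%N -> c m = 0) ->
  series (fun m => c m * t ^+ m) k.+1 = c k * t ^+ k.
Proof.
move=> ck; rewrite /series /= big_nat_recr//= big_nat big1 ?add0r// => m /andP[_ mk].
by rewrite ck ?mul0r.
Qed.

(** The remainder of order [k + 1] is made at most half of the leading term, so for [t] non-zero
    [phi t] keeps the sign of [c k * t^k]. *)
Lemma expansion_leading_term (R : realType) (phi : R -> R) (c : R^nat)
    (sigma K : R) (k : nat) : 0 < sigma -> 0 <= K ->
  (forall M t, `|t| < sigma ->
     `|phi t - series (fun m => c m * t ^+ m) M| <= K * (`|t| / sigma) ^+ M) ->
  (forall m, (m < k)%N -> c m = 0) -> c k != 0 ->
  exists2 delta, 0 < delta & forall t, `|t| < delta ->
    `|phi t - c k * t ^+ k| <= `|c k| / 2 * `|t| ^+ k.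
Proof.
move=> sigma0 K0 cK ck0 ck; exists (Num.min sigma (`|c k| / 2 * sigma ^+ k.+1 / (K + 1))).
  by rewrite lt_min sigma0 divr_gt0 ?mulr_gt0 ?exprn_gt0 ?normr_gt0// ltr_wpDl.
have K1 : 0 < K + 1 by rewrite ltr_wpDl.
move=> t; rewrite lt_min => /andP[ts tc].
have := cK k.+1 t ts; rewrite series_first_nonzero// => /le_trans; apply.
rewrite expr_div_n mulrA ler_pdivrMr ?exprn_gt0// exprS mulrA.
rewrite [leRHS]mulrAC ler_wpM2r ?exprn_ge0//.
rewrite ltr_pdivlMr// in tc; apply: le_trans (ltW tc).
by rewrite mulrC ler_wpM2l// lerDl.
Qed.

(** The order is only tested up to [n], so that functions vanishing identically, as [l] may do
    below, are covered by the first alternative. *)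
Lemma analytic1_order (R : realType) (phi : R -> R) (n : nat) : analytic1 phi ->
  (exists delta A, [/\ 0 < delta, 0 <= A &
    forall t, `|t| < delta -> `|phi t| <= A * `|t| ^+ n]) \/
  (exists k c delta, [/\ (k < n)%N, c != 0, 0 < delta &
    forall t, `|t| < delta -> `|phi t - c * t ^+ k| <= `|c| / 2 * `|t| ^+ k]).
Proof.
move=> /analytic1_expansion[c [sigma [K [sigma0 K0 cK]]]].
have [cn|] := boolp.pselect (forall m, (m < n)%N -> c m = 0).
  left; exists sigma, (K / sigma ^+ n); split=> //.
    by rewrite divr_ge0// exprn_ge0// ltW.
  move=> t ts; have := cK n t ts; rewrite /series /= big_nat big1 ?subr0.
    by rewrite expr_div_n mulrA mulrAC.
  by move=> m /andP[_ mn]; rewrite cn ?mul0r.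
move=> cn; right.
have exk : exists k, (k < n)%N && (c k != 0).
  apply: boolp.contrapT => nk; apply: cn => m mn; apply: boolp.contrapT => cm.
  by apply: nk; exists m; rewrite mn; apply/eqP.
case: (ex_minnP exk) => k /andP[kn ck] kmin.
have ck0 m : (m < k)%N -> c m = 0.
  move=> mk; apply/eqP; apply: contraTT mk => cm; rewrite -leqNgt.
  have [mn|nm] := ltnP m n; first by apply: kmin; rewrite mn.
  exact: leq_trans (ltnW kn) nm.
have [delta delta0 phik] := expansion_leading_term sigma0 K0 cK ck0 ck.
by exists k, (c k), delta.
Qed.

(** If there were no leading term, all coefficients would vanish by strong induction, and the
    geometric remainder would force [phi] to vanish near [0]. *)
Lemma analytic1_flat (R : realType) (phi : R -> R) : analytic1 phi ->
  (forall delta, 0 < delta -> exists2 t, `|t| < delta & phi t != 0) ->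
  exists k c delta, [/\ c != 0, 0 < delta &
    forall t, `|t| < delta -> `|phi t - c * t ^+ k| <= `|c| / 2 * `|t| ^+ k].
Proof.
move=> aphi phi_neq0; apply: boolp.contrapT => nk.
have [c [sigma [K [sigma0 K0 cK]]]] := analytic1_expansion aphi.
have c0 m : c m = 0.
  elim/ltn_ind: m => m IHm; apply: boolp.contrapT => /eqP cm.
  have [delta delta0 phim] := expansion_leading_term sigma0 K0 cK IHm cm.
  by apply: nk; exists m, (c m), delta.
have [t ts /eqP] := phi_neq0 _ sigma0; apply; apply/eqP; rewrite -normr_le0.
have z1 : `| (`|t| / sigma) | < 1.
  by rewrite ger0_norm ?divr_ge0 ?(ltW sigma0)// ltr_pdivrMr// mul1r.
have : (fun M => K * (`|t| / sigma) ^+ M) @ \oo --> K * 0.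
  by apply: cvgM; [exact: cvg_cst|exact: cvg_expr].
rewrite mulr0 => /(ler_cvg_to (cvg_cst `|phi t|)); apply; apply: nearW => M.
have := cK M t ts; rewrite /series /= big1 ?subr0// => m _.
by rewrite c0 mul0r.
Qed.

Lemma norm_le_distD (R : numDomainType) (x y : R) : `|x| <= `|x - y| + `|y|.
Proof. by rewrite -{1}(subrK y x) ler_normD. Qed.

Lemma uphalf_mul3 (k : nat) : odd k -> (uphalf (3 * k) * 2)%N = (k * 3).+1.
Proof. by move=> kodd; rewrite muln2 odd_uphalfK ?oddM// mulnC. Qed.

Lemma exists_small (R : realFieldType) (a b c d : R) :
  0 < a -> 0 < b -> 0 < c -> 0 < d -> exists t, [/\ 0 < t < a, t < b, t < c & t < d].
Proof.
move=> a0 b0 c0 d0; exists (Num.min a (Num.min b (Num.min c d)) / 2).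
have m0 : 0 < Num.min a (Num.min b (Num.min c d)) by rewrite !lt_min a0 b0 c0.
have h : Num.min a (Num.min b (Num.min c d)) / 2 < Num.min a (Num.min b (Num.min c d)).
  by rewrite ltr_pdivrMr// ltr_pMr// ltr1n.
move: h; set x := _ / 2; rewrite !lt_min => /and4P[-> -> -> ->].
by rewrite divr_gt0.
Qed.

(* [b ~ c t^k] changes sign at [0], so [k] is odd; then [l^2 <= C |b|^3] forces
   [l = O(t^((3k+1)/2))], half an order better than [|b|^(3/2)]. *)
Lemma sign_change_small (R : realType) (b l : R -> R) (C delta : R) :
  analytic1 b -> analytic1 l -> 0 < delta ->
  (forall d, 0 < d -> exists2 t, - d < t <= 0 & 0 < b t) ->
  (forall t, 0 < t < delta -> b t <= 0) ->
  (forall t, `|t| < delta -> b t != 0 -> l t ^+ 2 <= C * `|b t| ^+ 3) ->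
  forall e, 0 < e ->
  (exists t, [/\ `|t| < e, 0 < b t & l t ^+ 2 <= e * `|b t| ^+ 3]) /\
  (exists t, [/\ `|t| < e, b t < 0 & l t ^+ 2 <= e * `|b t| ^+ 3]).
Proof.
move=> ab al delta0 bleft bright lb e e0.
have [|k [c [d [c0 d0 bk]]]] := analytic1_flat ab.
  move=> d d0; have [t /andP[td t0] bt] := bleft d d0.
  by exists t; [rewrite ler0_norm// ltrNl|rewrite gt_eqF].
(* If [c > 0], then [b t >= c * t^k / 2 > 0] just to the right of [0], against [bright]. *)
have c_lt0 : c < 0.
  rewrite lt_neqAle c0 /= leNgt; apply/negP => cgt.
  have [t [/andP[t0 td] tdelta _ _]] := exists_small d0 delta0 ltr01 ltr01.
  have := bright t; rewrite t0 tdelta => /(_ isT) bt.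
  have := bk t; rewrite (gtr0_norm t0) (gtr0_norm cgt) => /(_ td).
  have tk : 0 < t ^+ k by rewrite exprn_gt0.
  rewrite ler_norml => /andP[+ _]; have := mulr_gt0 cgt tk; lra.
(* For even [k], [b t <= c * t^k / 2 <= 0] also on the left, against [bleft]. *)
have kodd : odd k.
  apply: contraT => keven.
  have [t /andP[td t0] bt] := bleft d d0.
  have := bk t; rewrite (ler0_norm t0) ltrNl => /(_ td).
  rewrite exprNn -signr_odd (negbTE keven) expr0 !mul1r (ltr0_norm c_lt0).
  have tk : 0 <= t ^+ k by rewrite exprn_even_ge0.
  rewrite ler_norml => /andP[_]; have := mulr_le0_ge0 (ltW c_lt0) tk; lra.
(* Half of [|c|], so that [|b t|] lies between [a * |t|^k] and [3 * a * |t|^k]. *)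
set a := - c / 2.
have a0 : 0 < a by rewrite /a divr_gt0// oppr_gt0.
have bpos t : `|t| < d -> a * `|t| ^+ k <= `|b t| <= 3 * a * `|t| ^+ k.
  move=> td; have := bk t td; rewrite (ltr0_norm c_lt0) -/a => h.
  have ct : `|c * t ^+ k| = 2 * a * `|t| ^+ k.
    by rewrite normrM normrX (ltr0_norm c_lt0) /a; congr (_ * _); lra.
  have := norm_le_distD (b t) (c * t ^+ k).
  have := norm_le_distD (c * t ^+ k) (b t); rewrite (distrC (c * _)) ct.
  by move: h; rewrite -mulrA => *; apply/andP; split; lra.
have bsgn t : `|t| < d -> (0 < t -> b t < 0) /\ (t < 0 -> 0 < b t).
  move=> td; have := bk t td; rewrite (ltr0_norm c_lt0) ler_norml => /andP[h1 h2].
  split=> t0.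
    move: h2; rewrite (gtr0_norm t0); have tk : 0 < t ^+ k by rewrite exprn_gt0.
    have := mulr_gt0 a0 tk; rewrite /a; lra.
  move: h1; rewrite (ltr0_norm t0) exprNn -signr_odd kodd expr1.
  have tk : t ^+ k < 0 by rewrite exprn_odd_lt0.
  have := nmulr_llt0 a tk; rewrite a0 /a; lra.
(* For odd [k], [uphalf (3 * k)] is [(3 * k + 1) / 2]. If [l] has at least this order, [l^2] exceeds
   the order of [|b|^3] by one, and the spare factor [|t|] pushes the ratio below [e]. *)
have [[d' [A [d'0 A0 lA]]]|[j [c' [d' [jk c'0 d'0 lj]]]]] := analytic1_order (uphalf (3 * k)) al.
- have small t : `|t| < d -> `|t| < d' -> `|t| < e * a ^+ 3 / (A ^+ 2 + 1) ->
     l t ^+ 2 <= e * `|b t| ^+ 3.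
    move=> td td' te.
    have A1 : 0 < A ^+ 2 + 1 by rewrite ltr_wpDl// sqr_ge0.
    rewrite ltr_pdivlMr// in te.
    have /andP[ba _] := bpos t td.
    have h1 : l t ^+ 2 <= A ^+ 2 * (`|t| ^+ k) ^+ 3 * `|t|.
      rewrite -[l t ^+ 2]ger0_norm ?sqr_ge0// normrX.
      have -> : A ^+ 2 * (`|t| ^+ k) ^+ 3 * `|t| = (A * `|t| ^+ uphalf (3 * k)) ^+ 2.
        rewrite exprMn -!exprM -mulrA -exprSr; congr (_ * _ ^+ _).
        by rewrite uphalf_mul3.
      by rewrite lerXn2r// ?nnegrE ?mulr_ge0 ?exprn_ge0//; exact: lA.
    apply: le_trans h1 _.
    apply: (@le_trans _ _ (e * (a * `|t| ^+ k) ^+ 3)); last first.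
      by rewrite ler_wpM2l ?(ltW e0)// lerXn2r// nnegrE// mulr_ge0 ?(ltW a0)//.
    rewrite exprMn [leLHS]mulrAC [leRHS]mulrA; apply: ler_wpM2r; first by rewrite !exprn_ge0.
    apply: le_trans (ltW te); rewrite mulrC ler_wpM2l// lerDl//.
  have e'0 : 0 < e * a ^+ 3 / (A ^+ 2 + 1).
    apply: divr_gt0; first by rewrite mulr_gt0// exprn_gt0.
    by rewrite ltr_wpDl ?sqr_ge0.
  have [t [/andP[t0 td] td' te' te]] := exists_small d0 d'0 e'0 e0.
  split; [exists (- t)|exists t]; rewrite ?normrN gtr0_norm//; split=> //.
  + by apply: (bsgn _ _).2; rewrite ?normrN ?gtr0_norm// oppr_lt0.
  + by apply: small; rewrite normrN gtr0_norm.
  + by apply: (bsgn _ _).1; rewrite ?gtr0_norm.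
  + by apply: small; rewrite gtr0_norm.
(* A leading term of order [j] with [2 * j < 3 * k] makes [l^2] at least [c'^2 / 4 * t^(2 * j)],
   while [lb] bounds it by a multiple of [t^(3 * k)], which carries at least one more factor [t]. *)
- exfalso.
  have c'2 : 0 < c' ^+ 2 / 4 by rewrite divr_gt0// exprn_even_gt0.
  have aC : 0 < (3 * a) ^+ 3 * (`|C| + 1).
    apply: mulr_gt0; last by rewrite ltr_wpDl.
    by apply: exprn_gt0; apply: mulr_gt0.
  have d''0 : 0 < Num.min delta (c' ^+ 2 / 4 / ((3 * a) ^+ 3 * (`|C| + 1))).
    by rewrite lt_min delta0 divr_gt0.
  have [t [/andP[t0 td] td' + t1]] := exists_small d0 d'0 d''0 ltr01.
  rewrite lt_min => /andP[tdelta tc].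
  rewrite ltr_pdivlMr// in tc.
  have nt := gtr0_norm t0.
  have bt0 : b t != 0 by rewrite lt_eqF// (bsgn t _).1// nt.
  have := lb t; rewrite nt => /(_ tdelta bt0).
  have /andP[_ ba] : a * `|t| ^+ k <= `|b t| <= 3 * a * `|t| ^+ k by rewrite bpos// nt.
  have := lj t; rewrite nt => /(_ td') ljt.
  have lt_ge : `|c'| / 2 * t ^+ j <= `|l t|.
    have := norm_le_distD (c' * t ^+ j) (l t); rewrite distrC normrM.
    by rewrite (gtr0_norm (exprn_gt0 j t0)); lra.
  apply/negP; rewrite -ltNge.
  apply: (@lt_le_trans _ _ ((`|c'| / 2 * t ^+ j) ^+ 2)); last first.
    rewrite -[l t ^+ 2]ger0_norm ?sqr_ge0// normrX lerXn2r// nnegrE.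
    by rewrite mulr_ge0// ?divr_ge0// exprn_ge0// ltW.
  apply: (@le_lt_trans _ _ ((`|C| + 1) * (3 * a * t ^+ k) ^+ 3)).
    apply: (@le_trans _ _ ((`|C| + 1) * `|b t| ^+ 3)).
      by rewrite ler_wpM2r ?exprn_ge0//; apply: le_trans (ler_norm C) _; rewrite lerDl.
    rewrite ler_wpM2l// ?addr_ge0// lerXn2r ?nnegrE//.
      apply: mulr_ge0; first by apply: mulr_ge0 => //; exact: ltW.
      by rewrite exprn_ge0// ltW.
    by move: ba; rewrite nt.
  have jk2 : (j * 2 < k * 3)%N 
    by rewrite -ltnS -uphalf_mul3//; exact: (leq_mul jk (leqnn 2)).
  set T := t ^+ (j * 2).
  have T0 : 0 < T by rewrite exprn_gt0.
  have -> : (3 * a * t ^+ k) ^+ 3 = (3 * a) ^+ 3 * (t ^+ (k * 3 - j * 2).-1.+1 * T).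
    by rewrite exprMn -exprM -exprD prednK ?subn_gt0// subnK// ltnW.
  have -> : (`|c'| / 2 * t ^+ j) ^+ 2 = c' ^+ 2 / 4 * T.
    rewrite exprMn -exprM exprMn -normrX (ger0_norm (sqr_ge0 _)) exprVn.
    by congr (_ / _ * _); rewrite -natrX.
  apply: (@le_lt_trans _ _ (t * ((3 * a) ^+ 3 * (`|C| + 1)) * T)); last first.
    by rewrite ltr_pM2r.
  set m := (_ - _).-1; have tm : t ^+ m.+1 <= t.
    by rewrite exprS ler_piMr ?(ltW t0)// exprn_ile1// ltW.
  have -> : (`|C| + 1) * ((3 * a) ^+ 3 * (t ^+ m.+1 * T)) =
      t ^+ m.+1 * ((3 * a) ^+ 3 * (`|C| + 1)) * T by ring.
  by apply: ler_wpM2r; [exact: ltW|apply: ler_wpM2r; [exact: ltW|]].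
Qed.

(** The supremum of the parameters in [[0, 1]] where [b > 0]; continuity at [1] leaves an interval
    to its right. On the left positive values merely accumulate: before analyticity is used, [b]
    could oscillate there. *)
Lemma last_positive_point (R : realType) (b : R -> R) :
  b (1 + t) @[t --> (0 : R)] --> b 1 -> 0 < b 0 -> b 1 < 0 ->
  exists t0, [/\ 0 <= t0 < 1,
    forall d, 0 < d -> exists2 t, - d < t <= 0 & 0 < b (t0 + t) &
    forall t, 0 < t < 1 - t0 -> b (t0 + t) <= 0].
Proof.
move=> b1_cont b0 b1.
pose S := [set t | 0 <= t <= 1 /\ 0 < b t].
have S0 : S 0 by rewrite /S /= lexx ler01.
have Ssup : has_sup S.
  by split; [exists 0|exists 1 => t [/andP[]]].
have t0_ge : 0 <= sup S by exact: sup_upper_bound.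
have t0_lt : sup S < 1.
  have /cvgrPdist_lt/(_ (- b 1)) := b1_cont; rewrite oppr_gt0 => /(_ b1).
  move=> /nbhs_ballP[e /= e0 be].
  apply: (@le_lt_trans _ _ (1 - Num.min e 1 / 2)); last first.
    by rewrite ltrBlDr ltrDl divr_gt0// lt_min e0 ltr01.
  apply: ge_sup; first by exists 0.
  move=> t [/andP[t0 t1] bt]; rewrite leNgt; apply/negP => tt.
  have := be (t - 1); rewrite /ball /= sub0r normrN addrCA subrr addr0 => H.
  have : `|b 1 - b t| < - b 1.
    apply: H; rewrite ler0_norm ?subr_le0// opprB.
    have : Num.min e 1 <= e by rewrite ge_min lexx.
    lra.
  rewrite ltr_norml => /andP[]; lra.
exists (sup S); split; first by rewrite t0_ge.
- move=> d d0; have [t St dt] := sup_adherent d0 Ssup.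
  exists (t - sup S); last by rewrite addrC subrK; case: St.
  by rewrite subr_le0 sup_upper_bound// andbT; lra.
- move=> t /andP[t0 t1]; rewrite leNgt; apply/negP => bt.
  have : S (sup S + t) by split => //; apply/andP; split; lra.
  by move/(sup_upper_bound Ssup); lra.
Qed.

(** * Linear algebra in dimension three *)

Lemma sum_ord3 (V : nmodType) (F : 'I_3 -> V) : \sum_i F i = F 0 + F 1 + F 2.
Proof.
rewrite !big_ord_recr big_ord0 /= add0r; congr (F _ + F _ + F _); exact: val_inj.
Qed.

Lemma bilinE (R : realType) (G : 'M[R]_3) (v w : 'rV[R]_3) :
  bilin G v w = \sum_i \sum_j v 0 i * G i j * w 0 j.
Proof.
rewrite /bilin mxE exchange_big /=; apply: eq_bigr => j _.
by rewrite !mxE mulr_suml.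
Qed.

Lemma det2 (R : comPzRingType) (G : 'M[R]_2) :
  \det G = G 0 0 * G 1 1 - G 0 1 * G 1 0.
Proof.
rewrite (expand_det_row _ 0) !big_ord_recr big_ord0 /= add0r /cofactor.
rewrite !det_mx11 !mxE /= expr0 expr1 mul1r mulN1r mulrN.
by congr (G _ _ * G _ _ - G _ _ * G _ _); exact: val_inj.
Qed.

Lemma det3 (R : comPzRingType) (G : 'M[R]_3) :
  \det G = G 0 0 * (G 1 1 * G 2 2 - G 1 2 * G 2 1)
         - G 0 1 * (G 1 0 * G 2 2 - G 1 2 * G 2 0)
         + G 0 2 * (G 1 0 * G 2 1 - G 1 1 * G 2 0).
Proof.
have l00 : lift 0 0 = 1 :> 'I_3 by exact: val_inj.
have l01 : lift 0 1 = 2 :> 'I_3 by exact: val_inj.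
have l10 : lift 1 0 = 0 :> 'I_3 by exact: val_inj.
have l11 : lift 1 1 = 2 :> 'I_3 by exact: val_inj.
have l20 : lift 2 0 = 0 :> 'I_3 by exact: val_inj.
have l21 : lift 2 1 = 1 :> 'I_3 by exact: val_inj.
rewrite (expand_det_row _ 0) sum_ord3 /cofactor !det2.
rewrite !mxE l00 l01 l10 l11 l20 l21 /= expr0 expr1 -signr_odd expr0; ring.
Qed.

Definition cross (R : pzRingType) (v w : 'rV[R]_3) : 'rV[R]_3 :=
  \row_i (if i == 0 then v 0 1 * w 0 2 - v 0 2 * w 0 1
          else if i == 1 then v 0 2 * w 0 0 - v 0 0 * w 0 2
          else v 0 0 * w 0 1 - v 0 1 * w 0 0).

Lemma det_cross (R : comPzRingType) (v w z : 'rV[R]_3) :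
  \det (col_mx v (col_mx w z) : 'M[R]_3) = \sum_i cross v w 0 i * z 0 i.
Proof.
have i0 : 0 = lshift (1 + 1) 0 :> 'I_(1 + (1 + 1)) by exact: val_inj.
have i1 : 1 = rshift 1 (lshift 1 0) :> 'I_(1 + (1 + 1)) by exact: val_inj.
have i2 : 2 = rshift 1 (rshift 1 0) :> 'I_(1 + (1 + 1)) by exact: val_inj.
have M0 j : (col_mx v (col_mx w z) : 'M[R]_3) 0 j = v 0 j.
  by rewrite i0; exact: col_mxEu.
have M1 j : (col_mx v (col_mx w z) : 'M[R]_3) 1 j = w 0 j.
  by rewrite i1; apply: etrans (col_mxEd _ _ _ _) _; exact: col_mxEu.
have M2 j : (col_mx v (col_mx w z) : 'M[R]_3) 2 j = z 0 j.
  by rewrite i2; apply: etrans (col_mxEd _ _ _ _) _; exact: col_mxEd.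
rewrite det3 !M0 !M1 !M2 sum_ord3 !mxE /=; ring.
Qed.

(** Isolates the rank-one matrix [b^T *m c] where the two factors meet, so that parallelism of [b]
    and [c] can be used by rewriting. *)
Lemma mul_bilin (R : realType) (G : 'M[R]_3) (a b c d : 'rV[R]_3) :
  bilin G a b * bilin G c d = (a *m G *m (b^T *m c) *m G *m d^T) 0 0.
Proof.
rewrite /bilin; have -> : a *m G *m (b^T *m c) *m G *m d^T =
  (a *m G *m b^T) *m (c *m G *m d^T) by rewrite !mulmxA.
by rewrite [RHS]mxE big_ord1.
Qed.

Lemma bilin_sym (R : realType) (G : 'M[R]_3) (v w : 'rV[R]_3) :
  G^T = G -> bilin G v w = bilin G w v.
Proof.
move=> Gsym; rewrite /bilin.
have -> : v *m G *m w^T = (w *m G *m v^T)^T by rewrite !trmx_mul trmxK Gsym mulmxA.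
by rewrite mxE.
Qed.

Lemma bilinDl (R : realType) (G : 'M[R]_3) (v v' w : 'rV[R]_3) :
  bilin G (v + v') w = bilin G v w + bilin G v' w.
Proof. by rewrite /bilin !mulmxDl mxE. Qed.

Lemma bilinZl (R : realType) (G : 'M[R]_3) (a : R) (v w : 'rV[R]_3) :
  bilin G (a *: v) w = a * bilin G v w.
Proof. by rewrite /bilin -!scalemxAl mxE. Qed.

Lemma bilinZr (R : realType) (G : 'M[R]_3) (a : R) (v w : 'rV[R]_3) :
  bilin G v (a *: w) = a * bilin G v w.
Proof. by rewrite /bilin linearZ /= -scalemxAr mxE. Qed.

(* The cross product of the covectors dual to [v] and [w]: it spans the same line
   as the vector product, but is polynomial in [G], [v], [w]. *)
Definition normal_dir (R : realType) (G : 'M[R]_3) (v w : 'rV[R]_3) : 'rV[R]_3 :=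
  cross (v *m G) (w *m G).

Lemma sym_entries (R : realType) (G : 'M[R]_3) : G^T = G ->
  [/\ G 1 0 = G 0 1, G 2 0 = G 0 2 & G 2 1 = G 1 2].
Proof. by move=> /matrixP Gs; split; rewrite -[LHS]Gs mxE. Qed.

(** The cofactor identity: the cross product of the images of [v] and [w] is [\det G] times the
    image of [cross v w] under the inverse transpose of [G]. Pairing through [G] cancels the
    inverse. *)
Lemma bilin_normal (R : realType) (G : 'M[R]_3) (v w y : 'rV[R]_3) : G^T = G ->
  bilin G (normal_dir G v w) y = \det G * \sum_i cross v w 0 i * y 0 i.
Proof.
move=> /sym_entries[e1 e2 e3].
rewrite bilinE !sum_ord3 det3 !mxE /= !sum_ord3 !e1 !e2 !e3; ring.
Qed.

(** The Binet-Cauchy identity for [v], [w] and the dual covectors [v *m G], [w *m G]. *)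
Lemma cross_normal (R : realType) (G : 'M[R]_3) (v w : 'rV[R]_3) : G^T = G ->
  \sum_i cross v w 0 i * normal_dir G v w 0 i =
  bilin G v v * bilin G w w - bilin G v w ^+ 2.
Proof.
move=> /sym_entries[e1 e2 e3].
rewrite !bilinE !sum_ord3 !mxE /= !sum_ord3 !e1 !e2 !e3; ring.
Qed.

Lemma bilin_normal_normal (R : realType) (G : 'M[R]_3) (v w : 'rV[R]_3) :
  G^T = G -> bilin G (normal_dir G v w) (normal_dir G v w) =
  \det G * (bilin G v v * bilin G w w - bilin G v w ^+ 2).
Proof. by move=> Gs; rewrite bilin_normal// cross_normal. Qed.

Lemma normal_dir_ortho (R : realType) (G : 'M[R]_3) (v w : 'rV[R]_3) :
  G^T = G -> bilin G (normal_dir G v w) v = 0 /\ bilin G (normal_dir G v w) w = 0.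
Proof.
move=> Gs; rewrite !bilin_normal// !sum_ord3 !mxE /=.
by split; apply/eqP; rewrite mulf_eq0; apply/orP; right; apply/eqP; ring.
Qed.

(** [z] is annihilated by both covectors whose cross product is [normal_dir], hence is parallel to
    it. Symmetry of [z^T *m n] expresses this without a factor of proportionality, which fails to
    exist when the wrong vector is zero. *)
Lemma ortho_parallel_normal (R : realType) (G : 'M[R]_3) (v w z : 'rV[R]_3) :
  G^T = G -> bilin G z v = 0 -> bilin G z w = 0 ->
  z^T *m normal_dir G v w = (normal_dir G v w)^T *m z.
Proof.
move=> Gs; rewrite ![bilin G z _]bilin_sym// {1 2}/bilin /normal_dir.
move: (v *m G) (w *m G) => a b; rewrite !mxE !sum_ord3 !mxE => za zb.
suff H i j : z 0 i * cross a b 0 j = cross a b 0 i * z 0 j.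
  by apply/matrixP => i j; rewrite !mxE !big_ord1 ![_^T _ _]mxE.
have e01 : z 0 0 * cross a b 0 1 = cross a b 0 0 * z 0 1.
  rewrite !mxE /=; apply/eqP; rewrite -subr_eq0; apply/eqP.
  transitivity (a 0 2 * (b 0 0 * z 0 0 + b 0 1 * z 0 1 + b 0 2 * z 0 2) -
     b 0 2 * (a 0 0 * z 0 0 + a 0 1 * z 0 1 + a 0 2 * z 0 2)); first by ring.
  by rewrite za zb !mulr0 subrr.
have e02 : z 0 0 * cross a b 0 2 = cross a b 0 0 * z 0 2.
  rewrite !mxE /=; apply/eqP; rewrite -subr_eq0; apply/eqP.
  transitivity (b 0 1 * (a 0 0 * z 0 0 + a 0 1 * z 0 1 + a 0 2 * z 0 2) -
     a 0 1 * (b 0 0 * z 0 0 + b 0 1 * z 0 1 + b 0 2 * z 0 2)); first by ring.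
  by rewrite za zb !mulr0 subrr.
have e12 : z 0 1 * cross a b 0 2 = cross a b 0 1 * z 0 2.
  rewrite !mxE /=; apply/eqP; rewrite -subr_eq0; apply/eqP.
  transitivity (a 0 0 * (b 0 0 * z 0 0 + b 0 1 * z 0 1 + b 0 2 * z 0 2) -
     b 0 0 * (a 0 0 * z 0 0 + a 0 1 * z 0 1 + a 0 2 * z 0 2)); first by ring.
  by rewrite za zb !mulr0 subrr.
have I3 (k : 'I_3) : [\/ k = 0, k = 1 | k = 2].
  case: k => -[|[|[|//]]] ?; [apply: Or31|apply: Or32|apply: Or33]; exact: val_inj.
move: (cross a b) e01 e02 e12 => n e01 e02 e12.
have [-> | -> | ->] := I3 i; have [-> | -> | ->] := I3 j.
- exact: mulrC.
- exact: e01.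
- exact: e02.
- by rewrite mulrC -e01 mulrC.
- exact: mulrC.
- exact: e12.
- by rewrite mulrC -e02 mulrC.
- by rewrite mulrC -e12 mulrC.
- exact: mulrC.
Qed.

Lemma bilin_parallel_square (R : realType) (G : 'M[R]_3) (y z n : 'rV[R]_3) :
  G^T = G -> z^T *m n = n^T *m z ->
  bilin G y z ^+ 2 * bilin G n n = bilin G y n ^+ 2 * bilin G z z.
Proof.
move=> Gs zn.
have e1 : bilin G y z * bilin G n n = bilin G y n * bilin G z n.
  by rewrite !mul_bilin zn.
have e2 : bilin G y z * bilin G z n = bilin G y n * bilin G z z.
  by rewrite [bilin G z n]bilin_sym// !mul_bilin zn.
by rewrite expr2 -mulrA e1 mulrCA e2 mulrA -expr2.
Qed.

(** [z] and [normal_dir] are parallel, with squares [-beta] and [\det G * beta]; the ratio of the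
    squares is [-\det G] once the non-zero [beta] is cancelled. *)
Lemma vector_product_square (R : realType) (G : 'M[R]_3) (v w z y : 'rV[R]_3) :
  G^T = G -> bilin G z v = 0 -> bilin G z w = 0 ->
  bilin G z z = - bilin G v v * bilin G w w + bilin G v w ^+ 2 ->
  bilin G v v * bilin G w w - bilin G v w ^+ 2 != 0 ->
  bilin G y z ^+ 2 * (- \det G) = bilin G y (normal_dir G v w) ^+ 2.
Proof.
move=> Gs zv zw zz b0.
have := bilin_parallel_square y Gs (ortho_parallel_normal Gs zv zw).
rewrite bilin_normal_normal// zz => h; apply: (mulIf b0).
rewrite mulrN mulNr -mulrA h; ring.
Qed.

(** Guarantees that [vector_product], chosen by [xget], is not the default [0]. *)
Lemma vector_product_exists (R : realType) (G : 'M[R]_3) (v w : 'rV[R]_3) :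
  G^T = G -> \det G < 0 ->
  bilin G v v * bilin G w w - bilin G v w ^+ 2 != 0 ->
  exists z, [/\ bilin G z v = 0 /\ bilin G z w = 0,
    0 < \det (col_mx v (col_mx w z) : 'M[R]_3) &
    bilin G z z = - bilin G v v * bilin G w w + bilin G v w ^+ 2].
Proof.
move=> Gs detG; set b := _ - _ => b0.
have sq : 0 < Num.sqrt (- \det G) by rewrite sqrtr_gt0 oppr_gt0.
(* The square [-1 / \det G] of the factor turns [\det G * b] into [-b]; its sign makes the
   determinant, equal to the factor times [b], positive. *)
exists ((Num.sg b / Num.sqrt (- \det G)) *: normal_dir G v w); split.
- by rewrite !bilinZl; have [-> ->] := normal_dir_ortho v w Gs; rewrite !mulr0.
- rewrite det_cross (_ : \sum_i _ = Num.sg b / Num.sqrt (- \det G) * b).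
    by rewrite mulrAC -normrEsg divr_gt0// normr_gt0.
  move: (_ / _) => mu; rewrite /b -(cross_normal v w Gs) mulr_sumr.
  by apply: eq_bigr => i _; rewrite [X in _ * X]mxE mulrCA.
- rewrite bilinZl bilinZr bilin_normal_normal// -/b mulrA -expr2.
  rewrite expr_div_n sqr_sg b0 sqr_sqrtr ?oppr_ge0 ?(ltW detG)//.
  rewrite mul1r invrN mulrA mulNr mulVf ?lt_eqF// /b; ring.
Qed.

(** * Analytic maps between coordinate spaces *)

Lemma near_row_ball (R : realType) (n : nat) (x : 'rV[R]_n) (P : 'rV[R]_n -> Prop) :
  (\forall y \near x, P y) <->
  exists2 e : R, 0 < e & forall y, `|y - x| < e -> P y.
Proof.
split.
  move=> /nbhs_ballP[e /= e0 He]; exists e => // y yx; apply: He.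
  by rewrite mx_norm_ball /ball_ /= distrC.
move=> [e e0 He]; apply/nbhs_ballP; exists e => //= y.
by rewrite mx_norm_ball /ball_ /= distrC; exact: He.
Qed.

Lemma analytic_germ_eq (R : realType) (n : nat) (F G : 'rV[R]_n -> R)
    (x : 'rV[R]_n) :
  (\forall y \near x, F y = G y) -> analytic_germ F x -> analytic_germ G x.
Proof.
move=> /near_row_ball[e e0 FG] [rho [K [rho0 FK]]].
have e20 : 0 < e / 2 by rewrite divr_gt0.
exists (Num.min rho (e / 2)), K; split=> [|T D N NC gamma gammaN].
  by rewrite lt_min rho0.
apply: (function_class_le NC (FK T D N NC gamma _)) => // [i|t Dt].
  by apply: (function_class_le NC (gammaN i)) => //; rewrite ge_min lexx.
apply: FG; apply: (@le_lt_trans _ _ (e / 2)); last first.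
  by rewrite ltr_pdivrMr// ltr_pMr// ltr1n.
apply: norm_row_le => [|i]; first exact: ltW.
rewrite !mxE; apply: le_trans (function_class_bound NC (gammaN i) Dt) _.
by rewrite ge_min lexx orbT.
Qed.

(** Half of the radius pays for moving the centre from [x] to [y]; the bound [K] is unchanged. *)
Lemma analytic_germ_near (R : realType) (n : nat) (F : 'rV[R]_n -> R)
    (x : 'rV[R]_n) : analytic_germ F x -> \forall y \near x, analytic_germ F y.
Proof.
move=> [rho [K [rho0 FK]]]; apply/near_row_ball.
have rho20 : 0 < rho / 2 by rewrite divr_gt0.
exists (rho / 2) => // y yx; exists (rho / 2), K; split=> // T D N NC gamma gammaN.
apply: (FK T D N NC gamma) => i.
apply: (function_class_le NC (function_class_add NC (gammaN i)
  (function_class_cst NC (y 0 i - x 0 i)))) => [|t _]; last by rewrite addrA subrK.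
have := norm_coord_le (y - x) i; rewrite !mxE; lra.
Qed.

Lemma analytic_germ_continuous (R : realType) (n : nat) (F : 'rV[R]_n -> R)
    (x : 'rV[R]_n) : analytic_germ F x -> {for x, continuous F}.
Proof.
move=> aF; have [d [A [d0 A0 FA]]] := analytic_germ_taylor1_ball aF.
pose M := \sum_i `|'D_(delta_mx 0 i) F x|.
have M0 : 0 <= M by exact: sumr_ge0.
apply/(@cvgrPdist_le _ _ _ (nbhs x) (nbhs_filter x)) => e e0.
apply/near_row_ball.
exists (Num.min d (Num.min 1 (e / (M + A + 1)))).
  by rewrite !lt_min d0 ltr01 divr_gt0// ltr_wpDl// addr_ge0.
move=> y; rewrite !lt_min => /and3P[yd y1 ye].
rewrite ltr_pdivlMr in ye; last by rewrite ltr_wpDl// addr_ge0.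
have := FA _ yd; rewrite [x + _]addrC subrK => Fy.
rewrite distrC; have -> : F y - F x = (F y - F x - 'D_(y - x) F x) + 'D_(y - x) F x.
  by rewrite subrK.
apply: le_trans (ler_normD _ _) _.
have DM : `|'D_(y - x) F x| <= M * `|y - x|.
  rewrite analytic_germ_derive_sum// (le_trans (ler_norm_sum _ _ _))//.
  rewrite mulr_suml; apply: ler_sum => i _.
  by rewrite normrM mulrC ler_wpM2l//; exact: norm_coord_le.
have A2 : A * `|y - x| ^+ 2 <= A * `|y - x|.
  by rewrite ler_wpM2l// expr2 ler_piMr// ltW.
have := normr_ge0 (y - x); lra.
Qed.

Definition analytic_row (R : realType) (n m : nat) (F : 'rV[R]_n -> 'rV[R]_m)
    (x : 'rV[R]_n) : Prop := forall k, analytic_germ (fun y => F y 0 k) x.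

Lemma near_ord (T : Type) (m : nat) (F : set_system T) (FF : Filter F)
    (P : 'I_m -> T -> Prop) :
  (forall i, \forall x \near F, P i x) -> \forall x \near F, forall i, P i x.
Proof. by move=> FP; exact: (@filter_forall _ _ P _ FF). Qed.

Lemma analytic_row_near (R : realType) (n m : nat) (F : 'rV[R]_n -> 'rV[R]_m)
    (x : 'rV[R]_n) : analytic_row F x -> \forall y \near x, analytic_row F y.
Proof. by move=> aF; apply: (near_ord (nbhs_filter x)) => k; exact: analytic_germ_near. Qed.

Lemma analytic_row_continuous (R : realType) (n m : nat)
    (F : 'rV[R]_n -> 'rV[R]_m) (x : 'rV[R]_n) :
  analytic_row F x -> {for x, continuous F}.
Proof.
move=> aF; apply/(@cvgrPdist_le _ _ _ (nbhs x) (nbhs_filter x)) => e e0.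
have : \forall y \near x, forall i, `|F x 0 i - F y 0 i| <= e.
  apply: (near_ord (nbhs_filter x)) => i; have := analytic_germ_continuous (aF i).
  by move=> /cvgrPdist_le/(_ e e0).
by apply: filterS => y Fy; apply: norm_row_le => [|i]; [exact: ltW|rewrite !mxE].
Qed.

Lemma analytic_row_nbhs (R : realType) (n m : nat) (F : 'rV[R]_n -> 'rV[R]_m)
    (x : 'rV[R]_n) (P : set 'rV[R]_m) :
  analytic_row F x -> (\forall y \near F x, P y) -> \forall x' \near x, P (F x').
Proof. by move=> /analytic_row_continuous Fx nP; apply: Fx. Qed.

Lemma analytic_row_derivable (R : realType) (n m : nat)
    (F : 'rV[R]_n -> 'rV[R]_m) (x v : 'rV[R]_n) :
  analytic_row F x -> derivable F x v.
Proof.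
move=> aF; apply/derivable_mxP => i j; rewrite (ord1 i).
by have [] := analytic_germ_is_derive v (aF j).
Qed.

Lemma analytic_row_deriveE (R : realType) (n m : nat)
    (F : 'rV[R]_n -> 'rV[R]_m) (x v : 'rV[R]_n) (k : 'I_m) :
  analytic_row F x -> 'D_v F x 0 k = 'D_v (fun y => F y 0 k) x.
Proof. by move=> aF; rewrite derive_mx ?mxE//; exact: analytic_row_derivable. Qed.

Lemma analytic_row_derive (R : realType) (n m : nat)
    (F : 'rV[R]_n -> 'rV[R]_m) (x v : 'rV[R]_n) :
  analytic_row F x -> analytic_row ('D_v F) x.
Proof.
move=> aF k; apply: analytic_germ_eq (analytic_germ_derive v (aF k)).
by apply: filterS (analytic_row_near aF) => y /analytic_row_deriveE ->.
Qed.

Lemma analytic_row_deriveD (R : realType) (n m : nat)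
    (F : 'rV[R]_n -> 'rV[R]_m) (x v w : 'rV[R]_n) :
  analytic_row F x -> 'D_(v + w) F x = 'D_v F x + 'D_w F x.
Proof.
move=> aF; apply/rowP => k; have E u := analytic_row_deriveE u k aF.
apply: etrans (E _) _; apply: etrans (analytic_germ_deriveD v w (aF k)) _.
by rewrite mxE -!E.
Qed.

Lemma analytic_row_deriveZ (R : realType) (n m : nat)
    (F : 'rV[R]_n -> 'rV[R]_m) (x v : 'rV[R]_n) (a : R) :
  analytic_row F x -> 'D_(a *: v) F x = a *: 'D_v F x.
Proof.
move=> aF; apply/rowP => k; have E u := analytic_row_deriveE u k aF.
apply: etrans (E _) _; apply: etrans (analytic_germ_deriveZ v a (aF k)) _.
by rewrite mxE -E.
Qed.

Lemma row_of_derive (R : realType) (n m : nat) (X : 'rV[R]_n -> 'rV[R]_m)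
    (q w : 'rV[R]_n) : analytic_row X q ->
  \row_i 'D_w (fun x => X x 0 i) q = 'D_w X q.
Proof. by move=> aX; apply/rowP => i; rewrite mxE analytic_row_deriveE. Qed.

Lemma analytic_row_chain (R : realType) (n m k : nat)
    (F : 'rV[R]_m -> 'rV[R]_k) (X : 'rV[R]_n -> 'rV[R]_m) (q w : 'rV[R]_n) :
  analytic_row F (X q) -> analytic_row X q ->
  'D_w (fun x => F (X x)) q = 'D_('D_w X q) F (X q).
Proof.
move=> aF aX.
have chain i := analytic_germ_chain w (aF i) aX.
have dFX : derivable (fun x => F (X x)) q w.
  apply/derivable_mxP => j l; rewrite (ord1 j); exact: (@ex_derive _ _ _ _ _ _ _ (chain l)).
apply/rowP => i; rewrite [RHS]analytic_row_deriveE// derive_mx// mxE.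
by rewrite -(row_of_derive w aX); exact: (@derive_val _ _ _ _ _ _ _ (chain i)).
Qed.

(** In the last term the direction ['D_u X q] is frozen at [q] before differentiating, so this term
    is the Hessian of [F]; the motion of the direction is accounted for by the first term. *)
Lemma analytic_germ_chain2 (R : realType) (n m : nat)
    (F : 'rV[R]_m -> R) (X : 'rV[R]_n -> 'rV[R]_m) (q u w : 'rV[R]_n) :
  analytic_germ F (X q) -> analytic_row X q ->
  'D_w (fun x => 'D_u (fun y => F (X y)) x) q =
  'D_('D_w ('D_u X) q) F (X q) +
  'D_('D_w X q) (fun y => 'D_('D_u X q) F y) (X q).
Proof.
move=> aF aX.
(* The first-order chain rule holds on a neighbourhood of [q], so its right-hand side may be
   differentiated as a sum of products. *)
have near1 : \forall x \near q, 'D_u (fun y => F (X y)) x =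
    (\sum_i (fun y => 'D_u X y 0 i * 'D_(delta_mx 0 i) F (X y))) x.
  have nX := analytic_row_near aX.
  have nF : \forall x \near q, analytic_germ F (X x).
    exact: (analytic_row_nbhs aX (analytic_germ_near aF)).
  apply: filterS2 nX nF => x aXx aFx.
  rewrite [LHS](@derive_val _ _ _ _ _ _ _ (analytic_germ_chain u aFx aXx)).
  rewrite row_of_derive// analytic_germ_derive_sum//.
  by elim/big_ind2: _ => // a1 a2 b1 b2 -> ->.
rewrite (near_eq_derive _ near1).
have aDu := analytic_row_derive u aX.
have dphi i : is_derive q w (fun y => 'D_u X y 0 i) ('D_w ('D_u X) q 0 i).
  by rewrite analytic_row_deriveE//; exact: analytic_germ_is_derive.
have dpsi i : is_derive q w (fun y => 'D_(delta_mx 0 i) F (X y))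
    ('D_('D_w X q) ('D_(delta_mx 0 i) F) (X q)).
  rewrite -(row_of_derive w aX); apply: (analytic_germ_chain w _ aX).
  exact: analytic_germ_derive.
have dprod i := @is_deriveM _ _ _ _ _ _ _ _ (dphi i) (dpsi i).
rewrite derive_sum => [|i]; last by have [] := dprod i.
under eq_bigr => i _ do rewrite (@derive_val _ _ _ _ _ _ _ (dprod i)).
rewrite big_split /= addrC; congr (_ + _).
  rewrite analytic_germ_derive_sum//.
  by apply: eq_bigr => i _; rewrite /GRing.scale /= mulrC.
have near2 : \forall y \near X q, 'D_('D_u X q) F y =
    (\sum_i ('D_u X q 0 i *: ('D_(delta_mx 0 i) F))) y.
  apply: filterS (analytic_germ_near aF) => y aFy.
  rewrite analytic_germ_derive_sum//.
  by elim/big_ind2: _ => // a1 a2 b1 b2 -> ->.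
have dD i : is_derive (X q) ('D_w X q) ('D_(delta_mx 0 i) F)
    ('D_('D_w X q) ('D_(delta_mx 0 i) F) (X q)).
  exact/analytic_germ_is_derive/analytic_germ_derive.
rewrite (near_eq_derive _ near2) derive_sum => [|i]; last first.
  by apply: derivableZ; have [] := dD i.
by apply: eq_bigr => i _; rewrite deriveZ//; have [] := dD i.
Qed.

(** Derivability is a hypothesis here, to pass to components; in the application the composite is
    again a coordinate expression of [f], which is analytic. *)
Lemma analytic_row_chain2 (R : realType) (n m k : nat)
    (F : 'rV[R]_m -> 'rV[R]_k) (X : 'rV[R]_n -> 'rV[R]_m) (q u w : 'rV[R]_n) :
  analytic_row F (X q) -> analytic_row X q ->
  derivable (fun x => 'D_u (fun y => F (X y)) x) q w ->
  'D_w (fun x => 'D_u (fun y => F (X y)) x) q =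
  'D_('D_w ('D_u X) q) F (X q) +
  'D_('D_w X q) (fun y => 'D_('D_u X q) F y) (X q).
Proof.
move=> aF aX dFX; apply/rowP => i; rewrite derive_mx// mxE.
transitivity ('D_w (fun x => 'D_u (fun y => F (X y) 0 i) x) q).
  apply: near_eq_derive.
  have nX := analytic_row_near aX.
  have nF : \forall x \near q, analytic_row F (X x).
    exact: (analytic_row_nbhs aX (analytic_row_near aF)).
  apply: filterS2 nX nF => x aXx aFx.
  have dFXx : derivable (fun y => F (X y)) x u.
    apply/derivable_mxP => j l; rewrite (ord1 j).
    exact: (@ex_derive _ _ _ _ _ _ _ (analytic_germ_chain u (aFx l) aXx)).
  by rewrite (derive_mx dFXx) mxE.
rewrite (analytic_germ_chain2 _ _ (aF i) aX) [RHS]mxE; congr (_ + _).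
  by rewrite analytic_row_deriveE.
rewrite analytic_row_deriveE; last exact: analytic_row_derive.
apply: near_eq_derive; apply: filterS (analytic_row_near aF) => y aFy.
by rewrite analytic_row_deriveE.
Qed.

(** * Changes of charts *)

Lemma near_image (R : realType) (M : topologicalType) (c : chart R M) (p : M) :
  dom c p -> \forall y \near fwd c p, (fwd c @` dom c) y.
Proof.
by move=> cp; apply: open_nbhs_nbhs; split; [exact: img_open|exists p].
Qed.

Lemma near_overlap (R : realType) (M : topologicalType) (c c' : chart R M) (p : M) :
  dom c p -> dom c' p -> \forall y \near fwd c p, overlap c c' y.
Proof.
move=> cp c'p.
have bcont : {in fwd c @` dom c, continuous (bwd c)}.
  by rewrite -continuous_open_subspace; [exact: bwd_continuous|exact: img_open].
have imp : fwd c p \in fwd c @` dom c by rewrite inE; exists p.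
have nc' : \forall y \near fwd c p, dom c' (bwd c y).
  apply: (bcont _ imp); rewrite fwdK//; apply: open_nbhs_nbhs; split => //.
  exact: dom_open.
apply: filterS2 (near_image cp) nc' => y [p' cp' <-]; rewrite fwdK// => c'p'.
by exists p'.
Qed.

Lemma transition_fwd (R : realType) (M : topologicalType) (c c' : chart R M) (p : M) :
  dom c p -> transition c c' (fwd c p) = fwd c' p.
Proof. by move=> cp; rewrite /transition /= fwdK. Qed.

Lemma transition_row (R : realType) (M : topologicalType)
    (A : oriented_analytic_manifold R M) (c c' : chart R M) (p : M) :
  atlas A c -> atlas A c' -> dom c p -> dom c' p ->
  analytic_row (transition c c') (fwd c p).
Proof.
move=> Ac Ac' cp c'p k; apply: analytic_at_germ.
by apply: (transition_analytic Ac Ac' k); exists p.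
Qed.

Lemma derive_transitionK (R : realType) (M : topologicalType)
    (A : oriented_analytic_manifold R M) (c c' : chart R M) (p : M) (a : 'rV[R]_3) :
  atlas A c -> atlas A c' -> dom c p -> dom c' p ->
  'D_('D_a (transition c c') (fwd c p)) (transition c' c) (fwd c' p) = a.
Proof.
move=> Ac Ac' cp c'p.
have t1 := transition_row Ac Ac' cp c'p.
have t2 := transition_row Ac' Ac c'p cp.
rewrite -(transition_fwd c' cp) in t2 *.
apply: etrans (esym (analytic_row_chain a t2 t1)) _.
rewrite -[RHS](derive_id (fwd c p)); apply: near_eq_derive.
apply: filterS (near_overlap cp c'p) => y [p' [cp' c'p'] <-].
by rewrite !transition_fwd.
Qed.

Lemma near_domain (R : realType) (M : topologicalType)
    (U : set 'rV[R]_2) (f : 'rV[R]_2 -> M) (c : chart R M) (q : 'rV[R]_2) :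
  open U -> {within U, continuous f} -> U q -> dom c (f q) ->
  \forall q' \near q, U q' /\ dom c (f q').
Proof.
move=> Uo fcont Uq cq.
have {}fcont : {in U, continuous f} by rewrite -continuous_open_subspace.
have Uq' : q \in U by rewrite inE.
have nU : \forall q' \near q, U q' by apply: open_nbhs_nbhs; split.
have nc : \forall q' \near q, dom c (f q').
  by apply: (fcont _ Uq'); apply: open_nbhs_nbhs; split => //; exact: dom_open.
by apply: filterS2 nU nc.
Qed.

Lemma coord_row (R : realType) (M : topologicalType)
    (A : oriented_analytic_manifold R M) (U : set 'rV[R]_2) (f : 'rV[R]_2 -> M)
    (c : chart R M) (q : 'rV[R]_2) :
  analytic_map A U f -> atlas A c -> U q -> dom c (f q) ->
  analytic_row (fun q => fwd c (f q)) q.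
Proof.
move=> [_ fan] Ac Uq cq k; apply: analytic_at_germ; exact: (fan c Ac k).
Qed.

Lemma near_coord_transition (R : realType) (M : topologicalType)
    (U : set 'rV[R]_2) (f : 'rV[R]_2 -> M) (c c' : chart R M) (q : 'rV[R]_2) :
  open U -> {within U, continuous f} -> U q -> dom c' (f q) ->
  \forall q' \near q, transition c' c (fwd c' (f q')) = fwd c (f q').
Proof.
move=> Uo fcont Uq c'q; apply: filterS (near_domain Uo fcont Uq c'q) => q' [_ c'q'].
exact: transition_fwd.
Qed.

(** [tangent_map] uses the chart chosen at [f q], which may jump with [q]. In a fixed chart the
    components are derivatives of one analytic map. *)
Lemma comp_in_tangent (R : realType) (M : topologicalType)
    (A : oriented_analytic_manifold R M) (U : set 'rV[R]_2) (f : 'rV[R]_2 -> M)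
    (c : chart R M) (q w : 'rV[R]_2) :
  open U -> analytic_map A U f -> atlas A c -> U q -> dom c (f q) ->
  comp_in A c (f q) (tangent_map A f q w) = 'D_w (fun q => fwd c (f q)) q.
Proof.
move=> Uo fan Ac Uq cq; rewrite /comp_in /tangent_map.
set c' := chart_at A (f q).
have Ac' : atlas A c' by exact: chart_at_atlas.
have c'q : dom c' (f q) by exact: chart_at_dom.
have t1 := transition_row Ac' Ac c'q cq.
have t2 := coord_row fan Ac' Uq c'q.
apply: etrans (esym (analytic_row_chain w t1 t2)) _.
apply: near_eq_derive; exact: near_coord_transition fan.1 Uq c'q.
Qed.

Lemma comp_inD (R : realType) (M : topologicalType)
    (A : oriented_analytic_manifold R M) (c : chart R M) (p : M) (v w : 'rV[R]_3) :
  atlas A c -> dom c p -> comp_in A c p (v + w) = comp_in A c p v + comp_in A c p w.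
Proof.
move=> Ac cp; apply: analytic_row_deriveD.
exact: transition_row (chart_at_atlas A p) Ac (chart_at_dom A p) cp.
Qed.

Lemma comp_inZ (R : realType) (M : topologicalType)
    (A : oriented_analytic_manifold R M) (c : chart R M) (p : M) (a : R) (v : 'rV[R]_3) :
  atlas A c -> dom c p -> comp_in A c p (a *: v) = a *: comp_in A c p v.
Proof.
move=> Ac cp; apply: analytic_row_deriveZ.
exact: transition_row (chart_at_atlas A p) Ac (chart_at_dom A p) cp.
Qed.

(** The second derivative of the transition map, produced by the second-order chain rule, is the
    inhomogeneous term of [christoffel_change]; hence the usual coordinate formula holds in every
    chart. *)
Lemma comp_in_cov_deriv (R : realType) (M : topologicalType)
    (A : oriented_analytic_manifold R M) (nabla : affine_connection A)
    (U : set 'rV[R]_2) (f : 'rV[R]_2 -> M)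
    (c : chart R M) (q u w : 'rV[R]_2) :
  open U -> analytic_map A U f -> atlas A c -> U q -> dom c (f q) ->
  let X := fun q => fwd c (f q) in
  comp_in A c (f q) (cov_deriv nabla f w (fun q' => tangent_map A f q' u) q) =
  'D_w ('D_u X) q +
  christoffel_form (christoffel nabla c (X q)) ('D_w X q) ('D_u X q).
Proof.
move=> Uo fan Ac Uq cq X; rewrite /cov_deriv.
set c' := chart_at A (f q).
pose X' q' := fwd c' (f q').
have Ac' : atlas A c' by exact: chart_at_atlas.
have c'q : dom c' (f q) by exact: chart_at_dom.
have t1 := transition_row Ac' Ac c'q cq.
have aX' : analytic_row X' q := coord_row fan Ac' Uq c'q.
have aX : analytic_row X q := coord_row fan Ac Uq cq.
have nc' := near_domain Uo fan.1 Uq c'q.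
(* Inside the derivative [c'] stays the chart at [f q], whereas each tangent vector is given in the
   chart at its own base point. *)
have -> : 'D_w (fun q' => comp_in A c' (f q') (tangent_map A f q' u)) q =
    'D_w ('D_u X') q.
  apply: near_eq_derive; apply: filterS nc' => q' [Uq' c'q'].
  exact: (comp_in_tangent u Uo fan Ac' Uq' c'q').
rewrite comp_inD// /comp_in -/c'.
rewrite (christoffel_change nabla Ac' Ac); last by exists (f q).
rewrite transition_fwd// -/(X q).
have Xw v : 'D_(tangent_map A f q v) (transition c' c) (fwd c' (f q)) = 'D_v X q.
  exact: (comp_in_tangent v Uo fan Ac Uq cq).
apply: etrans (addrA _ _ _) _.
apply: (congr2 +%R); last exact: (congr2 (christoffel_form _) (Xw w) (Xw u)).
have nX : \forall x \near q, 'D_u (fun y => transition c' c (X' y)) x = 'D_u X x.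
  apply: filterS nc' => x [Ux c'x]; apply: near_eq_derive.
  exact: near_coord_transition fan.1 Ux c'x.
have dX : derivable (fun x => 'D_u (fun y => transition c' c (X' y)) x) q w.
  apply: (@near_eq_derivable _ _ _ ('D_u X)).
    by apply: filterS nX.
  exact/analytic_row_derivable/analytic_row_derive.
have := analytic_row_chain2 t1 aX' dX.
by rewrite (near_eq_derive _ nX) => ->.
Qed.

(** * The metric and the connection in a chart *)

Lemma analytic_row_derive_mx (R : realType) (n m : nat)
    (F : 'rV[R]_n -> 'rV[R]_m) (x v : 'rV[R]_n) :
  analytic_row F x ->
  'D_v F x = v *m \matrix_(i < n) 'D_(delta_mx 0 i) F x.
Proof.
move=> aF; rewrite mulmx_sum_row {1}[v]row_sum_delta.
elim/big_ind2: _ => [||i _].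
- by rewrite derive0.
- by move=> a1 a2 b1 b2 <- <-; rewrite analytic_row_deriveD.
- by rewrite analytic_row_deriveZ// rowK.
Qed.

Lemma of_compK (R : realType) (M : topologicalType)
    (A : oriented_analytic_manifold R M) (c : chart R M) (p : M) (v : 'rV[R]_3) :
  atlas A c -> dom c p -> of_comp A c (fwd c p) (comp_in A c p v) = v.
Proof.
move=> Ac cp; rewrite /of_comp fwdK//.
exact: derive_transitionK (chart_at_atlas A p) Ac (chart_at_dom A p) cp.
Qed.

Lemma inner_in_comp (R : realType) (M : topologicalType)
    (A : oriented_analytic_manifold R M) (g : lorentzian_metric A)
    (c : chart R M) (p : M) (v w : 'rV[R]_3) : atlas A c -> dom c p ->
  inner_in g c (fwd c p) (comp_in A c p v) (comp_in A c p w) = inner g p v w.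
Proof. by move=> Ac cp; rewrite /inner_in !of_compK// fwdK. Qed.

Lemma gram_det_lt0 (R : realType) (M : topologicalType)
    (A : oriented_analytic_manifold R M) (g : lorentzian_metric A) (p : M) :
  \det (gram g p) < 0.
Proof.
have [P [Pu PG]] := gram_signature g p.
have := congr1 determinant PG; rewrite !det_mulmx det_tr det_diag.
rewrite big_ord_recl !big_ord_recr big_ord0 /= !mxE /= !mulr1 => dP.
have P2 : 0 < \det P ^+ 2.
  by rewrite exprn_even_gt0//= -unitfE -unitmxE.
rewrite -(pmulr_rlt0 _ P2) (_ : _ * _ = -1) ?ltrN10//.
by rewrite -dP; ring.
Qed.

(** The coefficients of the metric in the fixed chart [c]; unlike [gram], they are analytic
    functions of the coordinates. *)
Definition metric_mx (R : realType) (M : topologicalType)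
    (A : oriented_analytic_manifold R M) (g : lorentzian_metric A)
    (c : chart R M) (x : 'rV[R]_3) : 'M[R]_3 :=
  \matrix_(i, j) inner_in g c x (delta_mx 0 i) (delta_mx 0 j).

(** [P] is the Jacobian of the transition to the chart chosen at [p]. Symmetry and the sign of the
    determinant pass from [gram] to [metric_mx] by this congruence. *)
Lemma metric_mx_congr (R : realType) (M : topologicalType)
    (A : oriented_analytic_manifold R M) (g : lorentzian_metric A)
    (c : chart R M) (p : M) : atlas A c -> dom c p ->
  exists P, [/\ P \in unitmx, metric_mx g c (fwd c p) = P *m gram g p *m P^T &
    forall a b, inner_in g c (fwd c p) a b = bilin (metric_mx g c (fwd c p)) a b].
Proof.
move=> Ac cp; set c' := chart_at A p.
have t := transition_row Ac (chart_at_atlas A p) cp (chart_at_dom A p).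
have t' := transition_row (chart_at_atlas A p) Ac (chart_at_dom A p) cp.
have TP a := analytic_row_derive_mx a t.
have TQ a := analytic_row_derive_mx a t'.
move: TP TQ; set P := \matrix_i _; set Q := \matrix_i _ => TP TQ.
have PQ (a : 'rV[R]_3) : a *m P *m Q = a.
  rewrite -TP -TQ.
  exact: derive_transitionK Ac (chart_at_atlas A p) cp (chart_at_dom A p).
have Pu : P \in unitmx.
  suff PQ1 : P *m Q = 1%:M by exact: (mulmx1_unit PQ1).1.
  by apply/row_matrixP => i; rewrite !rowE mulmxA PQ mulmx1.
have inE a b : inner_in g c (fwd c p) a b = bilin (P *m gram g p *m P^T) a b.
  by rewrite /inner_in /inner /of_comp fwdK// !TP /bilin !trmx_mul !mulmxA.
have GE : metric_mx g c (fwd c p) = P *m gram g p *m P^T.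
  apply/matrixP => i j; rewrite mxE inE /bilin -rowE.
  by rewrite trmx_delta -colE !mxE.
by exists P; split => // a b; rewrite inE GE.
Qed.

Lemma metric_mx_sym (R : realType) (M : topologicalType)
    (A : oriented_analytic_manifold R M) (g : lorentzian_metric A)
    (c : chart R M) (p : M) : atlas A c -> dom c p ->
  (metric_mx g c (fwd c p))^T = metric_mx g c (fwd c p).
Proof.
move=> Ac cp; have [P [_ -> _]] := metric_mx_congr g Ac cp.
by rewrite !trmx_mul trmxK gram_sym mulmxA.
Qed.

Lemma metric_mx_det_lt0 (R : realType) (M : topologicalType)
    (A : oriented_analytic_manifold R M) (g : lorentzian_metric A)
    (c : chart R M) (p : M) : atlas A c -> dom c p ->
  \det (metric_mx g c (fwd c p)) < 0.
Proof.
move=> Ac cp; have [P [Pu -> _]] := metric_mx_congr g Ac cp.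
rewrite !det_mulmx det_tr mulrAC -expr2 nmulr_llt0 ?gram_det_lt0//.
by rewrite exprn_even_gt0//= -unitfE -unitmxE.
Qed.

Lemma metric_mx_germ (R : realType) (M : topologicalType)
    (A : oriented_analytic_manifold R M) (g : lorentzian_metric A)
    (c : chart R M) (p : M) (i j : 'I_3) : atlas A c -> dom c p ->
  analytic_germ (fun y => metric_mx g c y i j) (fwd c p).
Proof.
move=> Ac cp; apply: analytic_at_germ.
under boolp.eq_fun do rewrite mxE.
by apply: (@gram_analytic _ _ _ g c Ac (delta_mx 0 i) (delta_mx 0 j)); exists p.
Qed.

Lemma christoffel_form_sum (R : realType) (Gamma : 'I_3 -> 'M[R]_3) (a b : 'rV[R]_3) :
  christoffel_form Gamma a b = \sum_i \sum_j (a 0 i * b 0 j) *: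
    christoffel_form Gamma (delta_mx 0 i) (delta_mx 0 j).
Proof.
apply/rowP => k; rewrite mxE bilinE summxE; apply: eq_bigr => i _.
rewrite summxE; apply: eq_bigr => j _.
rewrite !mxE /bilin -rowE trmx_delta -colE !mxE; ring.
Qed.

Lemma bilin_suml (R : realType) (G : 'M[R]_3) (I : finType) (v : I -> 'rV[R]_3)
    (w : 'rV[R]_3) : bilin G (\sum_i v i) w = \sum_i bilin G (v i) w.
Proof. by rewrite /bilin !mulmx_suml summxE. Qed.

Lemma bilin_delta_r (R : realType) (G : 'M[R]_3) (v w : 'rV[R]_3) :
  bilin G v w = \sum_k w 0 k * bilin G v (delta_mx 0 k).
Proof.
rewrite /bilin mxE; apply: eq_bigr => k _.
by rewrite trmx_delta -colE !mxE mulrC.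
Qed.

(* [dG i j k] stands for the [i]-th partial derivative of the metric coefficient
   [G j k]. *)
Definition koszul_form (R : realType) (dG : 'I_3 -> 'I_3 -> 'I_3 -> R)
    (a b d : 'rV[R]_3) : R :=
  \sum_i \sum_j \sum_k a 0 i * b 0 j * d 0 k *
    ((dG i j k + dG j i k - dG k i j) / 2).

(** On coordinate fields, whose brackets vanish, metric compatibility expands the three derivatives
    into six terms; absence of torsion cancels four of them and leaves twice the wanted one. This is
    where the analyticity of the Christoffel terms comes from. *)
Lemma koszul (R : realType) (M : topologicalType)
    (A : oriented_analytic_manifold R M) (g : lorentzian_metric A)
    (nabla : affine_connection A) (c : chart R M) (p : M) (a b d : 'rV[R]_3) :
  is_levi_civita g nabla -> atlas A c -> dom c p ->
  bilin (metric_mx g c (fwd c p))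
    (christoffel_form (christoffel nabla c (fwd c p)) a b) d =
  koszul_form (fun i j k =>
    'D_(delta_mx 0 i) (fun y => metric_mx g c y j k) (fwd c p)) a b d.
Proof.
move=> [tf mc] Ac cp; set x := fwd c p.
have imx : (fwd c @` dom c) x by exists p.
have [_ [_ _ inE]] := metric_mx_congr g Ac cp.
have Gs := metric_mx_sym g Ac cp.
rewrite -/x in inE Gs; set G := metric_mx g c x in inE Gs *.
set Ga := christoffel_form _.
have GaC v w : Ga v w = Ga w v := tf c Ac x imx v w.
pose e (i : 'I_3) : 'rV[R]_3 := delta_mx 0 i.
have dGE i j k : 'D_(e i) (fun y => metric_mx g c y j k) x =
    bilin G (Ga (e i) (e j)) (e k) + bilin G (e j) (Ga (e i) (e k)).
  under boolp.eq_fun do rewrite mxE.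
  by rewrite (mc c Ac x imx) !inE.
rewrite /koszul_form {1}/Ga christoffel_form_sum bilin_suml.
apply: eq_bigr => i _; rewrite bilin_suml; apply: eq_bigr => j _.
rewrite bilinZl bilin_delta_r mulr_sumr; apply: eq_bigr => k _.
rewrite mulrA; congr (_ * _); rewrite !dGE.
rewrite -/(Ga _ _) -/(e i) -/(e j) -/(e k).
rewrite (GaC (e j) (e i)) (GaC (e k) (e i)) (GaC (e k) (e j)).
rewrite (bilin_sym (e j) (Ga (e i) (e k)) Gs).
by rewrite (_ : _ + _ - _ = bilin G (Ga (e i) (e j)) (e k) * 2); [field|ring].
Qed.

(** * The invariants of the surface in a fixed chart *)

Lemma bilin_comb (R : realType) (G : 'M[R]_3) (a b c : R) (u v w y : 'rV[R]_3) :
  bilin G (a *: u + - b *: v + c *: w) y =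
  a * bilin G u y - b * bilin G v y + c * bilin G w y.
Proof. by rewrite !bilinDl !bilinZl mulNr. Qed.

Lemma comp_in_comb (R : realType) (M : topologicalType)
    (A : oriented_analytic_manifold R M) (c : chart R M) (p : M) (x y z : R)
    (u v w : 'rV[R]_3) : atlas A c -> dom c p ->
  comp_in A c p (x *: u + y *: v + z *: w) =
  x *: comp_in A c p u + y *: comp_in A c p v + z *: comp_in A c p w.
Proof. by move=> Ac cp; rewrite !comp_inD// !comp_inZ. Qed.

(* Up to a factor, the numerator of the mean curvature; since [normal_dir] is not
   normalized, it is analytic also where the surface is light-like. *)
Definition curvature_num (R : realType) (G : 'M[R]_3)
    (dG : 'I_3 -> 'I_3 -> 'I_3 -> R) (Xu Xv Xuu Xuv Xvv : 'rV[R]_3) : R :=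
  let n := normal_dir G Xu Xv in
  bilin G Xu Xu * (bilin G Xvv n + koszul_form dG Xv Xv n)
  - 2 * bilin G Xu Xv * (bilin G Xuv n + koszul_form dG Xv Xu n)
  + bilin G Xv Xv * (bilin G Xuu n + koszul_form dG Xu Xu n).

Section LocalExpressions.
Context {R : realType} {M : topologicalType} {A : oriented_analytic_manifold R M}
  (g : lorentzian_metric A) (c : chart R M) (f : 'rV[R]_2 -> M).

Definition local_coord (q : 'rV[R]_2) : 'rV[R]_3 := fwd c (f q).

Definition local_metric (q : 'rV[R]_2) : 'M[R]_3 := metric_mx g c (local_coord q).

Definition local_dmetric (q : 'rV[R]_2) (i j k : 'I_3) : R :=
  'D_(delta_mx 0 i) (fun y => metric_mx g c y j k) (local_coord q).

Definition local_beta (q : 'rV[R]_2) : R :=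
  let Xu := 'D_(@du R) local_coord q in let Xv := 'D_(@dv R) local_coord q in
  bilin (local_metric q) Xu Xu * bilin (local_metric q) Xv Xv
  - bilin (local_metric q) Xu Xv ^+ 2.

Definition local_curvature_num (q : 'rV[R]_2) : R :=
  curvature_num (local_metric q) (local_dmetric q)
    ('D_(@du R) local_coord q) ('D_(@dv R) local_coord q)
    ('D_(@du R) ('D_(@du R) local_coord) q) ('D_(@dv R) ('D_(@du R) local_coord) q)
    ('D_(@dv R) ('D_(@dv R) local_coord) q).

End LocalExpressions.

Lemma inner_local (R : realType) (M : topologicalType)
    (A : oriented_analytic_manifold R M) (g : lorentzian_metric A)
    (c : chart R M) (f : 'rV[R]_2 -> M) (q : 'rV[R]_2) (v w : 'rV[R]_3) :
  atlas A c -> dom c (f q) ->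
  inner g (f q) v w =
  bilin (local_metric g c f q) (comp_in A c (f q) v) (comp_in A c (f q) w).
Proof.
move=> Ac cq; rewrite -(inner_in_comp g v w Ac cq).
by have [_ [_ _ ->]] := metric_mx_congr g Ac cq.
Qed.

Lemma inner_tangent_local (R : realType) (M : topologicalType)
    (A : oriented_analytic_manifold R M) (g : lorentzian_metric A)
    (U : set 'rV[R]_2) (c : chart R M) (f : 'rV[R]_2 -> M) (q v w : 'rV[R]_2) :
  open U -> analytic_map A U f -> atlas A c -> U q -> dom c (f q) ->
  inner g (f q) (tangent_map A f q v) (tangent_map A f q w) =
  bilin (local_metric g c f q) ('D_v (local_coord c f) q) ('D_w (local_coord c f) q).
Proof.
move=> Uo fan Ac Uq cq; apply: etrans (inner_local g _ _ Ac cq) _.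
exact: (congr2 (bilin _) (comp_in_tangent v Uo fan Ac Uq cq)
  (comp_in_tangent w Uo fan Ac Uq cq)).
Qed.

Lemma beta_local (R : realType) (M : topologicalType)
    (A : oriented_analytic_manifold R M) (g : lorentzian_metric A)
    (U : set 'rV[R]_2) (c : chart R M) (f : 'rV[R]_2 -> M) (q : 'rV[R]_2) :
  open U -> analytic_map A U f -> atlas A c -> U q -> dom c (f q) ->
  beta g f q = local_beta g c f q.
Proof.
move=> Uo fan Ac Uq cq.
have E v w := inner_tangent_local g v w Uo fan Ac Uq cq.
exact: (congr2 (fun x y => x - y) (congr2 *%R (E _ _) (E _ _))
  (congr1 (fun x => x ^+ 2) (E _ _))).
Qed.

(** With [B = |beta|] and [s] the length of the vector product: the denominator of [H] contributes
    [4 * B^2] to the square, and the normalization of the normal one more factor [B]. *)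
Lemma normalized_quotient_square (R : realType) (x y z a b d s B : R) :
  0 < B -> s ^+ 2 = B ->
  ((x * (s^-1 * d) - 2 * y * (s^-1 * b) + z * (s^-1 * a)) / (2 * B)) ^+ 2 *
    (4 * B ^+ 3) = (x * d - 2 * y * b + z * a) ^+ 2.
Proof.
move=> B0 sB; have s0 : s != 0 by apply: contraTneq B0 => s0; rewrite -sB s0 expr0n ltxx.
by rewrite -sB; field.
Qed.

Lemma mean_curvature_local (R : realType) (M : topologicalType)
    (A : oriented_analytic_manifold R M) (g : lorentzian_metric A)
    (nabla : affine_connection A)
    (U : set 'rV[R]_2) (c : chart R M) (f : 'rV[R]_2 -> M) (q : 'rV[R]_2) :
  is_levi_civita g nabla ->
  open U -> analytic_map A U f -> atlas A c -> U q -> dom c (f q) ->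
  beta g f q != 0 ->
  mean_curvature g nabla f q ^+ 2 *
    (4 * `|beta g f q| ^+ 3 * - \det (local_metric g c f q)) =
  local_curvature_num g c f q ^+ 2.
Proof.
move=> lc Uo fan Ac Uq cq b0.
have [[zu zv] _ zz] : is_vector_product g (f q) (@fu R M A f q) (@fv R M A f q)
    (vector_product g (f q) (@fu R M A f q) (@fv R M A f q)).
  apply: xgetPex.
  exact: (vector_product_exists (gram_sym g (f q)) (gram_det_lt0 g (f q)) b0).
move: zu zv zz; set z := vector_product _ _ _ _ => zu zv zz.
have alg (x y w : R) : - x * y + w ^+ 2 = - (x * y - w ^+ 2) by ring.
have zb : inner g (f q) z z = - beta g f q := etrans zz (alg _ _ _).
have bpos : 0 < `|beta g f q| by rewrite normr_gt0.
(* The numerator of [H] is the product of this single vector with the normal. The three terms must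
   be gathered first, since [normal_dir] and the vector product are compared through squares
   only. *)
pose Y := g11 g f q *: fvv nabla f q + - (2 * g12 g f q) *: fuv nabla f q +
  g22 g f q *: fuu nabla f q.
have YE y : inner g (f q) Y y = g11 g f q * inner g (f q) (fvv nabla f q) y -
    2 * g12 g f q * inner g (f q) (fuv nabla f q) y +
    g22 g f q * inner g (f q) (fuu nabla f q) y.
  exact: bilin_comb.
have HY : mean_curvature g nabla f q ^+ 2 * (4 * `|beta g f q| ^+ 3) =
    inner g (f q) Y z ^+ 2.
  have sq2 : Num.sqrt `|inner g (f q) z z| ^+ 2 = `|beta g f q|.
    by rewrite zb normrN sqr_sqrtr// ltW.
  rewrite YE -(normalized_quotient_square _ _ _ _ _ _ bpos sq2).
  have nE y : inner g (f q) y (unit_normal g f q) =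
      (Num.sqrt `|inner g (f q) z z|)^-1 * inner g (f q) y z by exact: bilinZr.
  apply: (congr1 (fun x => (x / (2 * `|beta g f q|)) ^+ 2 * (4 * `|beta g f q| ^+ 3))).
  apply: (congr2 +%R); first apply: (congr2 (fun x y => x - y)).
  - exact: (congr1 ( *%R (g11 g f q)) (nE (fvv nabla f q))).
  - exact: (congr1 ( *%R (2 * g12 g f q)) (nE (fuv nabla f q))).
  - exact: (congr1 ( *%R (g22 g f q)) (nE (fuu nabla f q))).
rewrite mulrA HY (inner_local g Y z Ac cq).
have Gs : (local_metric g c f q)^T = local_metric g c f q by exact: metric_mx_sym.
have tg w := comp_in_tangent w Uo fan Ac Uq cq.
have il v w := inner_local g v w Ac cq.
have gE v w := inner_tangent_local g v w Uo fan Ac Uq cq.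
have cE u w := comp_in_cov_deriv nabla u w Uo fan Ac Uq cq.
have TY n : bilin (local_metric g c f q) (comp_in A c (f q) Y) n =
    g11 g f q * bilin (local_metric g c f q) (comp_in A c (f q) (fvv nabla f q)) n -
    2 * g12 g f q * bilin (local_metric g c f q) (comp_in A c (f q) (fuv nabla f q)) n +
    g22 g f q * bilin (local_metric g c f q) (comp_in A c (f q) (fuu nabla f q)) n.
  apply: etrans (congr1 (fun x => bilin _ x n) (comp_in_comb _ _ _ _ _ _ Ac cq)) _.
  exact: bilin_comb.
have kE u w n : bilin (local_metric g c f q) (comp_in A c (f q)
    (cov_deriv nabla f w (fun q' => tangent_map A f q' u) q)) n =
    bilin (local_metric g c f q) ('D_w ('D_u (local_coord c f)) q) n +
    koszul_form (local_dmetric g c f q) ('D_w (local_coord c f) q)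
      ('D_u (local_coord c f) q) n.
  apply: etrans (congr1 (fun x => bilin _ x n) (cE u w)) _.
  apply: etrans (bilinDl _ _ _ _) _; congr (_ + _).
  exact: (koszul _ _ _ lc Ac cq).
rewrite (vector_product_square _ Gs (v := 'D_(@du R) (local_coord c f) q)
  (w := 'D_(@dv R) (local_coord c f) q)).
- congr (_ ^+ 2); rewrite TY.
  apply: (congr2 +%R); first apply: (congr2 (fun x y => x - y)).
  + exact: (congr2 *%R (gE _ _) (kE _ _ _)).
  + exact: (congr2 *%R (congr1 ( *%R 2) (gE _ _)) (kE _ _ _)).
  + exact: (congr2 *%R (gE _ _) (kE _ _ _)).
- apply: etrans zu; apply: esym; apply: etrans (il _ _) _.
  exact: (congr1 (bilin _ _) (tg _)).
- apply: etrans zv; apply: esym; apply: etrans (il _ _) _.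
  exact: (congr1 (bilin _ _) (tg _)).
- apply: etrans (esym (il z z)) _; apply: etrans zz _.
  exact: (congr2 (fun x y => x + y) (congr2 (fun x y => - x * y) (gE _ _) (gE _ _))
    (congr1 (fun x => x ^+ 2) (gE _ _))).
- by rewrite (beta_local g Uo fan Ac Uq cq) in b0.
Qed.

(** * Analyticity along lines *)

Definition analytic1_row (R : realType) (n : nat) (v : R -> 'rV[R]_n) : Prop :=
  forall i, analytic1 (fun t => v t 0 i).

Definition analytic1_mx (R : realType) (G : R -> 'M[R]_3) : Prop :=
  forall i j, analytic1 (fun t => G t i j).

Lemma analytic1_bilin (R : realType) (G : R -> 'M[R]_3) (v w : R -> 'rV[R]_3) :
  analytic1_mx G -> analytic1_row v -> analytic1_row w ->
  analytic1 (fun t => bilin (G t) (v t) (w t)).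
Proof.
move=> aG av aw.
rewrite (_ : (fun t => _) = (fun t => \sum_i \sum_j v t 0 i * G t i j * w t 0 j)).
  do 2!(apply: analytic1_sum => ? _).
  by apply: analytic1_mul => //; exact: analytic1_mul.
by apply/boolp.funext => t; rewrite bilinE.
Qed.

Lemma analytic1_sub (R : realType) (phi psi : R -> R) :
  analytic1 phi -> analytic1 psi -> analytic1 (fun t => phi t - psi t).
Proof. by move=> aphi apsi; apply: analytic1_add => //; exact: analytic1_opp. Qed.

Lemma analytic1_det (R : realType) (G : R -> 'M[R]_3) :
  analytic1_mx G -> analytic1 (fun t => \det (G t)).
Proof.
move=> aG; under boolp.eq_fun do rewrite det3.
apply: analytic1_add; first apply: analytic1_sub;
  by apply: analytic1_mul => //; apply: analytic1_sub; apply: analytic1_mul.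
Qed.

Lemma analytic1_cross (R : realType) (v w : R -> 'rV[R]_3) :
  analytic1_row v -> analytic1_row w -> analytic1_row (fun t => cross (v t) (w t)).
Proof.
move=> av aw i; under boolp.eq_fun do rewrite mxE.
by case: eqP => _; [|case: eqP => _]; apply: analytic1_sub; apply: analytic1_mul.
Qed.

Lemma analytic1_mulmx (R : realType) (G : R -> 'M[R]_3) (v : R -> 'rV[R]_3) :
  analytic1_mx G -> analytic1_row v -> analytic1_row (fun t => v t *m G t).
Proof.
move=> aG av i; under boolp.eq_fun do rewrite mxE.
by apply: analytic1_sum => j _; exact: analytic1_mul.
Qed.

Lemma analytic1_normal_dir (R : realType) (G : R -> 'M[R]_3) (v w : R -> 'rV[R]_3) :
  analytic1_mx G -> analytic1_row v -> analytic1_row w ->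
  analytic1_row (fun t => normal_dir (G t) (v t) (w t)).
Proof.
by move=> aG av aw; apply: analytic1_cross; exact: analytic1_mulmx.
Qed.

Lemma analytic1_koszul_form (R : realType) (dG : R -> 'I_3 -> 'I_3 -> 'I_3 -> R)
    (a b d : R -> 'rV[R]_3) : (forall i j k, analytic1 (fun t => dG t i j k)) ->
  analytic1_row a -> analytic1_row b -> analytic1_row d ->
  analytic1 (fun t => koszul_form (dG t) (a t) (b t) (d t)).
Proof.
move=> adG aa ab ad; do 3!(apply: analytic1_sum => ? _).
apply: analytic1_mul; first by apply: analytic1_mul => //; exact: analytic1_mul.
apply: analytic1_mul; last exact: analytic1_cst.
by apply: analytic1_sub => //; exact: analytic1_add.
Qed.

Lemma analytic1_curvature_num (R : realType) (G : R -> 'M[R]_3)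
    (dG : R -> 'I_3 -> 'I_3 -> 'I_3 -> R) (Xu Xv Xuu Xuv Xvv : R -> 'rV[R]_3) :
  analytic1_mx G -> (forall i j k, analytic1 (fun t => dG t i j k)) ->
  analytic1_row Xu -> analytic1_row Xv ->
  analytic1_row Xuu -> analytic1_row Xuv -> analytic1_row Xvv ->
  analytic1 (fun t => curvature_num (G t) (dG t) (Xu t) (Xv t) (Xuu t) (Xuv t) (Xvv t)).
Proof.
move=> aG adG aXu aXv aXuu aXuv aXvv.
have an := analytic1_normal_dir aG aXu aXv.
have aB v w := @analytic1_bilin _ G v w aG.
have aK a b d := @analytic1_koszul_form _ dG a b d adG.
apply: analytic1_add; first apply: analytic1_sub.
- by apply: analytic1_mul; [exact: aB|apply: analytic1_add; [exact: aB|exact: aK]].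
- apply: analytic1_mul; last by apply: analytic1_add; [exact: aB|exact: aK].
  by apply: analytic1_mul; [exact: analytic1_cst|exact: aB].
- by apply: analytic1_mul; [exact: aB|apply: analytic1_add; [exact: aB|exact: aK]].
Qed.

Lemma analytic1_line (R : realType) (n : nat) (F : 'rV[R]_n -> R) (q w : 'rV[R]_n) :
  analytic_germ F q -> analytic1 (fun t => F (q + t *: w)).
Proof.
move=> aF; apply: (analytic1_comp (gamma := fun t => q + t *: w)).
  by rewrite scale0r addr0.
move=> i; under boolp.eq_fun do rewrite !mxE.
apply: analytic1_add; first exact: analytic1_cst.
by apply: analytic1_mul; [exact: analytic1_id|exact: analytic1_cst].
Qed.

Lemma analytic1_local (R : realType) (M : topologicalType)
    (A : oriented_analytic_manifold R M) (g : lorentzian_metric A)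
    (U : set 'rV[R]_2) (c : chart R M) (f : 'rV[R]_2 -> M) (q w : 'rV[R]_2) :
  analytic_map A U f -> atlas A c -> U q -> dom c (f q) ->
  [/\ analytic1 (fun t => local_beta g c f (q + t *: w)),
      analytic1 (fun t => local_curvature_num g c f (q + t *: w)) &
      analytic1 (fun t => \det (local_metric g c f (q + t *: w)))].
Proof.
move=> fan Ac Uq cq.
have aX : analytic_row (local_coord c f) q := coord_row fan Ac Uq cq.
have line (F : 'rV[R]_2 -> 'rV[R]_3) : analytic_row F q ->
    analytic1_row (fun t => F (q + t *: w)).
  by move=> aF i; exact: (analytic1_line w (aF i)).
have aD v := analytic_row_derive v aX.
have aDD v v' := analytic_row_derive v' (aD v).
have comp F : analytic_germ F (local_coord c f q) ->
    analytic1 (fun t => F (local_coord c f (q + t *: w))).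
  move=> aF; apply: (analytic1_comp (gamma := fun t => local_coord c f (q + t *: w))).
    by rewrite scale0r addr0.
  exact: line.
have aG : analytic1_mx (fun t => local_metric g c f (q + t *: w)).
  move=> i j; exact: (comp (fun y => metric_mx g c y i j) (metric_mx_germ g i j Ac cq)).
have adG i j k : analytic1 (fun t => local_dmetric g c f (q + t *: w) i j k).
  exact: (comp _ (analytic_germ_derive (delta_mx 0 i) (metric_mx_germ g j k Ac cq))).
have aB v v' := analytic1_bilin aG (line _ (aD v)) (line _ (aD v')).
split.
- apply: analytic1_sub; first exact: analytic1_mul (aB _ _) (aB _ _).
  exact: analytic1_mul (aB _ _) (aB _ _).
- exact: (analytic1_curvature_num aG adG (line _ (aD _)) (line _ (aD _))
    (line _ (aDD _ _)) (line _ (aDD _ _)) (line _ (aDD _ _))).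
- exact: analytic1_det.
Qed.

(** * Small mean curvature near a change of causal type *)

Lemma half_double_bounds (R : realFieldType) (x y : R) :
  x < 0 -> `|x - y| < - x / 2 -> - x / 2 < - y < 2 * - x.
Proof.
by move=> x0; rewrite ltr_norml => /andP[h1 h2]; apply/andP; split; lra.
Qed.

Lemma sqr_le_norm (R : realDomainType) (x y : R) :
  0 <= y -> (x ^+ 2 <= y ^+ 2) = (`|x| <= y).
Proof.
by move=> y0; rewrite -[x ^+ 2]ger0_norm ?sqr_ge0// normrX ler_pXn2r// ?nnegrE.
Qed.

(** Read [h] as [H], [B] as [|beta|^3] and [d] as [-\det G]: boundedness of [H] becomes a bound on
    [l^2], and [d < 2 * D] yields the constant [8 * D * K^2]. *)
Lemma mul_sqr_le (R : realFieldType) (h K D d B : R) :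
  `|h| <= K -> 0 < d < 2 * D -> 0 <= B ->
  h ^+ 2 * (4 * B * d) <= 8 * D * K ^+ 2 * B.
Proof.
move=> hK /andP[d0 dD] B0; have K0 : 0 <= K := le_trans (normr_ge0 h) hK.
have -> : 8 * D * K ^+ 2 * B = K ^+ 2 * (4 * B * (2 * D)) by ring.
apply: ler_pM; rewrite ?sqr_ge0// ?sqr_le_norm//.
  by rewrite !mulr_ge0// ltW.
by apply: ler_wpM2l; [rewrite mulr_ge0|exact: ltW].
Qed.

(** The way back from [l^2] to [H]: since [4 * d > 2 * D], the threshold on [e'] is
    [2 * D * e^2]. *)
Lemma norm_le_mul_sqr (R : realFieldType) (h D d B e e' : R) :
  0 <= e -> 0 < D -> D / 2 < d -> 0 < B -> e' <= 2 * D * e ^+ 2 ->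
  h ^+ 2 * (4 * B * d) <= e' * B -> `|h| <= e.
Proof.
move=> e0 D0 Dd B0 e'e hle; rewrite -sqr_le_norm//.
have D2 : 0 < 2 * D by rewrite mulr_gt0.
rewrite -(ler_pM2l D2); apply: le_trans e'e; rewrite -(ler_pM2r B0).
apply: le_trans hle; have -> : 2 * D * h ^+ 2 * B = h ^+ 2 * (2 * D * B) by ring.
apply: ler_wpM2l; first exact: sqr_ge0.
by rewrite [4 * B * d]mulrAC; apply: ler_wpM2r; [exact: ltW|lra].
Qed.

Lemma mean_curvature_small_on_line (R : realType) (M : topologicalType)
    (A : oriented_analytic_manifold R M) (g : lorentzian_metric A)
    (nabla : affine_connection A) (U : set 'rV[R]_2) (f : 'rV[R]_2 -> M)
    (q w : 'rV[R]_2) (K delta : R) :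
  is_levi_civita g nabla -> open U -> analytic_map A U f -> U q ->
  (forall q, U q -> beta g f q != 0 -> `|mean_curvature g nabla f q| <= K) ->
  0 < delta ->
  (forall d, 0 < d -> exists2 t, - d < t <= 0 & 0 < beta g f (q + t *: w)) ->
  (forall t, 0 < t < delta -> beta g f (q + t *: w) <= 0) ->
  forall e, 0 < e ->
  (exists t, [/\ `|t| < e, 0 < beta g f (q + t *: w) &
     `|mean_curvature g nabla f (q + t *: w)| <= e]) /\
  (exists t, [/\ `|t| < e, beta g f (q + t *: w) < 0 &
     `|mean_curvature g nabla f (q + t *: w)| <= e]).
Proof.
move=> lc Uo fan Uq HK delta0 bleft bright e e0.
(* This one chart serves for all points of the line near [q]. *)
set c := chart_at A (f q).
have Ac : atlas A c by exact: chart_at_atlas.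
have cq : dom c (f q) by exact: chart_at_dom.
have [ab al ad] := analytic1_local g w fan Ac Uq cq.
set b := fun t => local_beta _ _ _ _ in ab; set l := fun t => local_curvature_num _ _ _ _ in al.
set G := fun t => local_metric g c f (q + t *: w); rewrite -/(G _) in ad.
have D0 : 0 < - \det (G 0).
  by rewrite oppr_gt0 /G scale0r addr0; exact: metric_mx_det_lt0.
set D := - \det (G 0) in D0.
have /cvgrPdist_lt/(_ (D / 2)) := analytic1_continuous ad.
rewrite divr_gt0// => /(_ isT) /nbhs_ballP[d1 /= d10 Gd1].
have /near_row_ball[r r0 Ur] := near_domain Uo fan.1 Uq cq.
have w1 : 0 < `|w| + 1 by rewrite ltr_wpDl.
have [d2 d20 loc] : exists2 d2 : R, 0 < d2 & forall t, `|t| < d2 ->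
    [/\ U (q + t *: w), dom c (f (q + t *: w)) & D / 2 < - \det (G t) < 2 * D].
  exists (Num.min d1 (r / (`|w| + 1))) => [|t]; first by rewrite lt_min d10 divr_gt0.
  rewrite lt_min => /andP[td1 tr]; have [|Ut ct] := Ur (q + t *: w).
    rewrite addrAC subrr add0r normrZ; rewrite ltr_pdivlMr// in tr.
    by apply: le_lt_trans tr; rewrite ler_wpM2l// lerDl.
  split=> //; apply: half_double_bounds; first by rewrite -oppr_gt0.
  by apply: Gd1; rewrite /ball /= sub0r normrN.
have bE t : `|t| < d2 -> beta g f (q + t *: w) = b t.
  by move=> /loc[Ut ct _]; exact: (beta_local g Uo fan Ac Ut ct).
have HE t : `|t| < d2 -> b t != 0 ->
    mean_curvature g nabla f (q + t *: w) ^+ 2 * (4 * `|b t| ^+ 3 * - \det (G t)) = l t ^+ 2.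
  move=> td bt0; have [Ut ct _] := loc t td.
  have := mean_curvature_local lc Uo fan Ac Ut ct.
  by rewrite (bE t td) => /(_ bt0).
(* The three bounds keep [t] small, keep the point inside the chart, and convert the estimate of
   [l^2] into one of [H]. *)
pose e' := Num.min e (Num.min d2 (2 * D * e ^+ 2)).
have e'0 : 0 < e' by rewrite !lt_min e0 d20 !mulr_gt0// exprn_gt0.
have K2 : 0 <= K ^+ 2 by exact: sqr_ge0.
have [||||tpos tneg] := @sign_change_small _ b l (8 * D * K ^+ 2)
    (Num.min delta d2) ab al _ _ _ _ e' e'0.
- by rewrite lt_min delta0.
- move=> d d0; have [|t td bt] := bleft (Num.min d d2); first by rewrite lt_min d0.
  move: td; rewrite ltrNl lt_min => /andP[/andP[td td2] t0].
  exists t; first by rewrite ltrNl td t0.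
  by rewrite -bE// ler0_norm.
- move=> t; rewrite lt_min => /and3P[t0 tdelta td2].
  by rewrite -bE ?gtr0_norm// bright// t0.
- move=> t; rewrite lt_min => /andP[tdelta td2] bt0.
  have [Ut _ /andP[D1 D2]] := loc t td2; rewrite -(HE t td2 bt0).
  apply: mul_sqr_le; last by rewrite exprn_ge0.
    by apply: (HK _ Ut); rewrite (bE t td2).
  by rewrite D2 andbT; apply: lt_trans D1; rewrite divr_gt0.
have fin t : `|t| < e' -> b t != 0 -> l t ^+ 2 <= e' * `|b t| ^+ 3 ->
    [/\ `|t| < e, `|t| < d2 & `|mean_curvature g nabla f (q + t *: w)| <= e].
  rewrite {1}/e' !lt_min => /and3P[te td2 _] bt0; rewrite -(HE t td2 bt0) => Hle.
  have [_ _ /andP[D1 _]] := loc t td2.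
  split => //; apply: (norm_le_mul_sqr _ D0 D1 _ _ Hle); first exact: ltW.
    by rewrite exprn_gt0// normr_gt0.
  by rewrite /e' !ge_min lexx !orbT.
split.
- have [t [te bt lt]] := tpos; exists t.
  have [tt td2 Ht] := fin t te (lt0r_neq0 bt) lt.
  by split; [exact: tt|rewrite (bE t td2); exact: bt|exact: Ht].
- have [t [te bt lt]] := tneg; exists t.
  have [tt td2 Ht] := fin t te (ltr0_neq0 bt) lt.
  by split; [exact: tt|rewrite (bE t td2); exact: bt|exact: Ht].
Qed.

Lemma beta_line_continuous (R : realType) (M : topologicalType)
    (A : oriented_analytic_manifold R M) (g : lorentzian_metric A)
    (U : set 'rV[R]_2) (f : 'rV[R]_2 -> M) (q w : 'rV[R]_2) :
  open U -> analytic_map A U f -> U q ->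
  beta g f (q + t *: w) @[t --> (0 : R)] --> beta g f q.
Proof.
move=> Uo fan Uq; set c := chart_at A (f q).
have Ac : atlas A c by exact: chart_at_atlas.
have cq : dom c (f q) by exact: chart_at_dom.
have [ab _ _] := analytic1_local g w fan Ac Uq cq.
have := analytic1_continuous ab; rewrite scale0r addr0.
rewrite -(beta_local g Uo fan Ac Uq cq).
have /near_row_ball[r r0 Ur] := near_domain Uo fan.1 Uq cq.
have w1 : 0 < `|w| + 1 by rewrite ltr_wpDl.
apply: cvg_trans; apply: near_eq_cvg; apply/nbhs_ballP.
exists (r / (`|w| + 1)) => [|t tb]; first exact: divr_gt0.
have tr : `|t| * (`|w| + 1) < r.
  by move: tb; rewrite /ball /= sub0r normrN ltr_pdivlMr.
have [|Ut ct] := Ur (q + t *: w).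
  rewrite addrAC subrr add0r normrZ.
  by apply: le_lt_trans tr; rewrite ler_wpM2l// lerDl.
exact: esym (beta_local g Uo fan Ac Ut ct).
Qed.

Lemma norm_convex_lt (R : realType) (n : nat) (x y p : 'rV[R]_n) (r t : R) :
  0 <= t <= 1 -> `|x - p| < r -> `|y - p| < r -> `|x + t *: (y - x) - p| < r.
Proof.
move=> /andP[t0 t1] xr yr.
have -> : x + t *: (y - x) - p = (1 - t) *: (x - p) + t *: (y - p).
  by apply/rowP => i; rewrite !mxE; ring.
apply: le_lt_trans (ler_normD _ _) _; rewrite !normrZ ger0_norm ?subr_ge0//.
rewrite (ger0_norm t0); have [->|tn0] := eqVneq t 0.
  by rewrite mul0r addr0 subr0 mul1r.
have tpos : 0 < t by rewrite lt_neqAle eq_sym tn0.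
have h1 : (1 - t) * `|x - p| <= (1 - t) * r by rewrite ler_wpM2l ?subr_ge0// ltW.
have h2 : t * `|y - p| < t * r by rewrite ltr_pM2l.
by apply: lt_le_trans (ler_ltD h1 h2) _; rewrite -mulrDl subrK mul1r.
Qed.

Lemma exists_small_mean_curvature (R : realType) (M : topologicalType)
    (A : oriented_analytic_manifold R M) (g : lorentzian_metric A)
    (nabla : affine_connection A) (U : set 'rV[R]_2) (f : 'rV[R]_2 -> M)
    (K : R) (p : 'rV[R]_2) :
  is_levi_civita g nabla -> open U -> analytic_map A U f ->
  (forall q, U q -> beta g f q != 0 -> `|mean_curvature g nabla f q| <= K) ->
  U p -> closure (spacelike_points g U f) p -> closure (timelike_points g U f) p ->
  forall e, 0 < e ->
  (exists q, [/\ spacelike_points g U f q, `|q - p| < e &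
     `|mean_curvature g nabla f q| <= e]) /\
  (exists q, [/\ timelike_points g U f q, `|q - p| < e &
     `|mean_curvature g nabla f q| <= e]).
Proof.
move=> lc Uo fan HK Up pplus pminus e e0.
have nU : \forall q \near p, U q by apply: open_nbhs_nbhs; split.
have /near_row_ball[r0 r00 Ur0] := nU.
pose r := Num.min r0 e.
have rpos : 0 < r by rewrite lt_min r00.
have Ur q : `|q - p| < r -> U q.
  by rewrite lt_min => /andP[qr _]; exact: Ur0.
have re : r <= e by rewrite ge_min lexx orbT.
have nr : \forall q \near p, `|q - p| < r by apply/near_row_ball; exists r.
have [x [[Ux bx] xr]] := pplus _ nr.
have [y [[Uy by_] yr]] := pminus _ nr.
pose w := y - x.
pose b t := beta g f (x + t *: w).
have b0 : 0 < b 0 by rewrite /b scale0r addr0.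
have xw : x + 1 *: w = y by rewrite scale1r addrC subrK.
have b1 : b 1 < 0 by rewrite /b xw.
have bcont : b (1 + t) @[t --> (0 : R)] --> b 1.
  have bE : (fun t => b (1 + t)) = (fun t => beta g f (y + t *: w)).
    by apply/boolp.funext => t; rewrite /b scalerDl addrA xw.
  have b1E : b 1 = beta g f y by rewrite /b xw.
  rewrite bE b1E; exact: (beta_line_continuous _ Uo fan Uy).
have [t0 [t01 bleft bright]] := last_positive_point bcont b0 b1.
(* This point generally differs from [p]; convexity of the ball keeps it within [r <= e] of [p]. *)
pose q := x + t0 *: w.
have qr : `|q - p| < r.
  by apply: norm_convex_lt => //; have /andP[-> /ltW ->] := t01.
have qt t : x + (t0 + t) *: w = q + t *: w by rewrite scalerDl addrA.
have t1 : 0 < 1 - t0 by rewrite subr_gt0; case/andP: t01.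
have left' d : 0 < d -> exists2 t, - d < t <= 0 & 0 < beta g f (q + t *: w).
  by case/bleft => t td; rewrite /b qt => bt; exact: (ex_intro2 _ _ t td bt).
have right' t : 0 < t < 1 - t0 -> beta g f (q + t *: w) <= 0.
  by move/bright; rewrite /b qt; exact.
(* The room left around [q] inside the ball; parameters small compared with it do not leave the
   ball. *)
pose s := r - `|q - p|.
have s0 : 0 < s by rewrite subr_gt0.
have w1 : 0 < `|w| + 1 by rewrite ltr_wpDl.
pose e' := Num.min e (s / (`|w| + 1)).
have e'0 : 0 < e' by rewrite lt_min e0 divr_gt0.
have near_q t : `|t| < e' -> `|q + t *: w - p| < r.
  rewrite lt_min => /andP[_]; rewrite ltr_pdivlMr// => tw.
  rewrite addrAC; apply: le_lt_trans (ler_normD _ _) _; rewrite normrZ.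
  rewrite -ltrBrDl; apply: le_lt_trans tw.
  by rewrite ler_wpM2l// lerDl.
have e'e : e' <= e by rewrite ge_min lexx.
have [[t [te bt Ht]] [t' [te' bt' Ht']]] :=
  mean_curvature_small_on_line lc Uo fan (Ur q qr) HK t1 left' right' e'0.
have ht := near_q t te; have ht' := near_q t' te'.
split; [exists (q + t *: w)|exists (q + t' *: w)]; split.
- by split; [exact: Ur|exact: bt].
- exact: lt_le_trans ht re.
- exact: le_trans Ht e'e.
- by split; [exact: Ur|exact: bt'].
- exact: lt_le_trans ht' re.
- exact: le_trans Ht' e'e.
Qed.

Lemma exists_sequence (R : realType) (S : set 'rV[R]_2) (H : 'rV[R]_2 -> R)
    (p : 'rV[R]_2) :
  (forall e, 0 < e -> exists q, [/\ S q, `|q - p| < e & `|H q| <= e]) ->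
  exists s : nat -> 'rV[R]_2, [/\ forall n, S (s n), s n @[n --> \oo] --> p &
    H (s n) @[n --> \oo] --> (0 : R)].
Proof.
move=> SH; have /boolp.choice[s sP] : forall n : nat, exists q,
    [/\ S q, `|q - p| < n.+1%:R^-1 & `|H q| <= n.+1%:R^-1].
  (* The tolerance at rank [n] is [1 / (n + 1)], positive already for [n = 0]. *)
  by move=> n; apply: SH; rewrite invr_gt0 ltr0n.
exists s; split.
- by move=> n; have [] := sP n.
- apply/cvgrPdist_le => e e0.
  apply: filterS (cvgr0_norm_le _ (@cvg_harmonic R) _ e0) => n /=.
  have [_ sn _] := sP n; rewrite distrC ger0_norm ?invr_ge0// => he.
  exact: le_trans (ltW sn) he.
- apply/cvgr0Pnorm_le => e e0.
  apply: filterS (cvgr0_norm_le _ (@cvg_harmonic R) _ e0) => n /=.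
  have [_ _ hn] := sP n; rewrite ger0_norm ?invr_ge0// => he.
  exact: le_trans hn he.
Qed.

Theorem theorem1p1 (R : realType) (M : topologicalType)
    (A : oriented_analytic_manifold R M) (g : lorentzian_metric A)
    (nabla : affine_connection A) (nabla_lc : is_levi_civita g nabla)
    (U : set 'rV[R]_2) (f : 'rV[R]_2 -> M)
    (U_open : open U) (U_connected : connected U)
    (f_immersion : analytic_immersion A U f)
    (Up_neq0 : spacelike_points g U f !=set0)
    (Um_neq0 : timelike_points g U f !=set0)
    (H_bounded : exists K : R, forall q : 'rV[R]_2,
       (spacelike_points g U f `|` timelike_points g U f) q ->
       `|mean_curvature g nabla f q| <= K)
    (p : 'rV[R]_2) (Up : U p)
    (p_cl_plus : closure (spacelike_points g U f) p)
    (p_cl_minus : closure (timelike_points g U f) p) :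
  (exists s : nat -> 'rV[R]_2,
     [/\ forall n, spacelike_points g U f (s n),
         s n @[n --> \oo] --> p
       & mean_curvature g nabla f (s n) @[n --> \oo] --> (0 : R)]) /\
  (exists s : nat -> 'rV[R]_2,
     [/\ forall n, timelike_points g U f (s n),
         s n @[n --> \oo] --> p
       & mean_curvature g nabla f (s n) @[n --> \oo] --> (0 : R)]).
Proof.
have [K HK] := H_bounded; have [fan _] := f_immersion.
have HK' q : U q -> beta g f q != 0 -> `|mean_curvature g nabla f q| <= K.
  move=> Uq; rewrite neq_lt => /orP[bq|bq]; apply: HK; [right|left]; exact: (conj Uq bq).
have small := exists_small_mean_curvature nabla_lc U_open fan HK' Up p_cl_plus p_cl_minus.
by split; apply: exists_sequence => e /small[].
Qed.
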